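(* Let $T\subset\mathbb{R}^3$ be a (nondegenerate) tetrahedron and let $k=0$. Then the weak Galerkin de Rham sequence $$\mathbb{R}^4\xrightarrow{\,I_w\,}V_k^{(1)}(T)\xrightarrow{\,\nabla_w\,}V_k^{(2)}(T)\xrightarrow{\,\nabla_w\times\,}V_k^{(3)}(T)\xrightarrow{\,\nabla_w\cdot\,}V_k^{(4)}(T)\xrightarrow{\,N\,}0$$ is exact, i.e. $\operatorname{Range}(I_w)=\operatorname{Ker}(\nabla_w)$, $\operatorname{Range}(\nabla_w)=\operatorname{Ker}(\nabla_w\times)$, $\operatorname{Range}(\nabla_w\times)=\operatorname{Ker}(\nabla_w\cdot)$, and $\operatorname{Range}(\nabla_w\cdot)=V_k^{(4)}(T)$.
   Context: Geometry and notation. $F(T)$, $E(T)$, $V(T)$ are the sets of faces, edges and vertices of $T$. $P_j(D)$ is the space of polynomials of total degree at most $j$ on $D$ (a volume, face or edge). $(\cdot,\cdot)_D$ is the $L^2$ inner product on $D$ (for the two end points $\partial e$ of an edge it is the sum of values at the end points). $\mathbf{n}$ is the unit outward normal on $\partial T$. For a face $f$, $\mathbf{n}_f$ is a fixed unit normal, $\mathbf{t}_{f,1},\mathbf{t}_{f,2}$ are orthogonal unit vectors tangential to $f$, and $\mathbf{t}_{\partial f}$ is the unit tangent on $\partial f$ oriented by the right-hand rule with respect to $\mathbf{n}_f$. For an edge $e$, $\mathbf{t}_e$ is a fixed unit tangent vector and $\mathbf{n}_{\partial e}$ is the unit outward direction (along the edge) at its two end points. Spaces. - $V_{k,0}^{(2)}(T)=V_{k,0}^{(3)}(T)=[P_k(T)]^3$,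 $V_{k,f}^{(2)}(f)=\{u_1\mathbf{t}_{f,1}+u_2\mathbf{t}_{f,2}: u_1,u_2\in P_k(f)\}$, $V_{k,e}^{(2)}(e)=\{u\mathbf{t}_e: u\in P_k(e)\}$, $V_{k,f}^{(3)}(f)=\{w_f\mathbf{n}_f: w_f\in P_k(f)\}$. - $V_k^{(1)}(T)=\{v=\{v_0,v_f,v_e,v_n\}: v_0\in P_k(T), v_f\in P_k(f), v_e\in P_k(e), v_n\in\mathbb{R}, f\in F(T), e\in E(T), n\in V(T)\}$ (one independent component for each face, edge and vertex). - $V_k^{(2)}(T)=\{\mathbf{u}=\{\mathbf{u}_0,\mathbf{u}_f,\mathbf{u}_e\}: \mathbf{u}_0\in V_{k,0}^{(2)}(T),\mathbf{u}_f\in V_{k,f}^{(2)}(f),\mathbf{u}_e\in V_{k,e}^{(2)}(e), f\in F(T), e\in E(T)\}$. - $V_k^{(3)}(T)=\{\mathbf{w}=\{\mathbf{w}_0,\mathbf{w}_f\}: \mathbf{w}_0\in V_{k,0}^{(3)}(T),\mathbf{w}_f\in V_{k,f}^{(3)}(f), f\in F(T)\}$. - $V_k^{(4)}(T)=P_k(T)$. Operators. - $I_w$ is the inclusion map assigning a constant value to each of $v_0$, $v_f$, $v_e$, $v_n$: $I_w(\alpha_1,\alpha_2,\alpha_3,\alpha_4)=\{v_0,v_f,v_e,v_n\}$ with $v_0=\alpha_1$, $v_f=\alpha_2$ on all faces, $v_e=\alpha_3$ on all edges, $v_n=\alpha_4$ at all vertices. - $\nabla_w v=\{\nabla_{w,0}v,\nabla_{w,f}v,\nabla_{w,e}v\}\in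 V_k^{(2)}(T)$, with $$(\nabla_{w,0}v,\varphi)_T=-(v_0,\nabla\cdot\varphi)_T+(v_f,\varphi\cdot\mathbf{n})_{\partial T}\quad\forall\varphi\in V_{k,0}^{(2)}(T),$$ $$(\nabla_{w,f}v,\theta\times\mathbf{n}_f)_f=-(v_f,(\nabla\times\theta)\cdot\mathbf{n}_f)_f+(v_e,\theta\cdot\mathbf{t}_{\partial f})_{\partial f}\quad\forall\theta\in V_{k,f}^{(2)}(f),$$ $$(\nabla_{w,e}v,\varphi\mathbf{t}_e)_e=-(v_e,\nabla\varphi\cdot\mathbf{t}_e)_e+(v_n,\varphi\,\mathbf{t}_e\cdot\mathbf{n}_{\partial e})_{\partial e}\quad\forall\varphi\mathbf{t}_e\in V_{k,e}^{(2)}(e).$$ - $\nabla_w\times\mathbf{u}=\{\nabla_{w,0}\times\mathbf{u},\nabla_{w,f}\times\mathbf{u}\}\in V_k^{(3)}(T)$, with $$(\nabla_{w,0}\times\mathbf{u},\theta)_T=(\mathbf{u}_0,\nabla\times\theta)_T+(\mathbf{u}_f,\theta\times\mathbf{n})_{\partial T}\quad\forall\theta\in V_{k,0}^{(3)}(T),$$ $$(\nabla_{w,f}\times\mathbf{u},\tau\mathbf{n}_f)_f=(\mathbf{u}_f,\nabla\tau\times\mathbf{n}_f)_f+(\mathbf{u}_e,\tau\mathbf{t}_{\partial f})_{\partial f}\quad\forall\tau\mathbf{n}_f\in V_{k,f}^{(3)}(f).$$ - $\nabla_w\cdot\mathbf{w}\in V_k^{(4)}(T)$, with $(\nabla_w\cdot\mathbf{w},\tau)_T=-(\mathbf{w}_0,\nabla\tau)_T+(\mathbf{w}_f,\tau\mathbf{n})_{\partial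 T}$ for all $\tau\in V_k^{(4)}(T)$. - $N$ is the null operator (zero map). *)

(* Defs.v *)
From HB Require Import structures.
From mathcomp Require Import all_boot all_order all_algebra.
From mathcomp Require Import all_classical all_reals all_analysis.
(* The notations of mpoly clash with those of MathComp-Analysis. *)
From mathcomp Require mpoly.
Import -(notations) mpoly.

Set Implicit Arguments.
Unset Strict Implicit.
Unset Printing Implicit Defensive.

Import Order.TTheory GRing.Theory Num.Theory.
Import numFieldNormedType.Exports.

Local Open Scope classical_set_scope.
Local Open Scope ring_scope.

Notation pt R := 'rV[R]_3.

(* The norm `|u| of matrices is the sup norm, hence [enorm]. *)
Definition dot (R : realType) (u v : pt R) : R := \sum_i u 0 i * v 0 i.

Definition enorm (R : realType) (u : pt R) : R := Num.sqrt (dot u u).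

(* Indices in 'I_3 are added modulo 3. *)
Definition cross (R : realType) (u v : pt R) : pt R :=
  \row_(i < 3) (u 0 (i + 1) * v 0 (i + 2) - u 0 (i + 2) * v 0 (i + 1)).

Definition partial (R : realType) (i : 'I_3) (f : pt R -> R) (x : pt R) : R :=
  'D_(delta_mx 0 i) f x.

Definition grad (R : realType) (f : pt R -> R) (x : pt R) : pt R :=
  \row_(i < 3) partial i f x.

Definition div (R : realType) (u : pt R -> pt R) (x : pt R) : R :=
  \sum_(i < 3) partial i (fun y => u y 0 i) x.

Definition curl (R : realType) (u : pt R -> pt R) (x : pt R) : pt R :=
  \row_(i < 3) (partial (i + 1) (fun y => u y 0 (i + 2)) x
                - partial (i + 2) (fun y => u y 0 (i + 1)) x).

(* A tetrahedron is given by its vertices p : 'I_4 -> pt R.  The face of index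
   f is the one opposite to the vertex p f, with vertices p (lift f j);
   an edge is a pair of vertex indices i < j. *)
Definition edge : finType := {e : 'I_4 * 'I_4 | (e.1 < e.2)%N}.

Definition src (e : edge) : 'I_4 := (val e).1.
Definition tgt (e : edge) : 'I_4 := (val e).2.

Definition edge_in (e : edge) (f : 'I_4) : bool := (f != src e) && (f != tgt e).

Definition nondegenerate_tetra (R : realType) (p : 'I_4 -> pt R) : Prop :=
  row_free (\matrix_(j < 3) (p (lift ord0 j) - p ord0)).

Definition hull (R : realType) (p : 'I_4 -> pt R) (A : {set 'I_4}) : set (pt R) :=
  [set x | exists l : 'I_4 -> R,
     [/\ forall i, 0 <= l i, forall i, i \notin A -> l i = 0,
         \sum_i l i = 1 & x = \sum_i l i *: p i]].

Definition tetra (R : realType) (p : 'I_4 -> pt R) : set (pt R) :=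
  hull p [set: 'I_4].
Definition face (R : realType) (p : 'I_4 -> pt R) (f : 'I_4) : set (pt R) :=
  hull p (~: [set f])%SET.
Definition segment (R : realType) (p : 'I_4 -> pt R) (e : edge) : set (pt R) :=
  hull p [set src e; tgt e]%SET.

Definition int_tetra (R : realType) (p : 'I_4 -> pt R) (g : pt R -> R) : R :=
  let xyz (q : R * R * R) : pt R := \row_(i < 3) [:: q.1.1; q.1.2; q.2]`_i in
  \int[(lebesgue_measure \x lebesgue_measure \x lebesgue_measure)%E]_(q in
    xyz @^-1` tetra p) g (xyz q).

(* Surface integral, through the affine parametrization of the face. *)
Definition int_face (R : realType) (p : 'I_4 -> pt R) (f : 'I_4)
    (g : pt R -> R) : R :=
  let a := p (lift f 0) in
  let b := p (lift f 1) - a in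
  let c := p (lift f 2) - a in
  enorm (cross b c) *
  \int[(lebesgue_measure \x lebesgue_measure)%E]_(q in
    [set q : R * R | [/\ 0 <= q.1, 0 <= q.2 & q.1 + q.2 <= 1]])
    g (a + q.1 *: b + q.2 *: c).

Definition int_edge (R : realType) (p : 'I_4 -> pt R) (e : edge)
    (g : pt R -> R) : R :=
  let a := p (src e) in
  let b := p (tgt e) - a in
  enorm b * \int[lebesgue_measure]_(s in `[0, 1]%classic) g (a + s *: b).

Record frame (R : realType) := Frame {
  nf : 'I_4 -> pt R;
  tf1 : 'I_4 -> pt R;
  tf2 : 'I_4 -> pt R;
  te : edge -> pt R }.

Definition is_frame (R : realType) (p : 'I_4 -> pt R) (F : frame R) : Prop :=
  (forall f, enorm (nf F f) = 1 /\
     forall i j, dot (nf F f) (p (lift f i) - p (lift f j)) = 0) /\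
  (forall f, [/\ enorm (tf1 F f) = 1, enorm (tf2 F f) = 1,
     dot (tf1 F f) (tf2 F f) = 0,
     dot (tf1 F f) (nf F f) = 0 & dot (tf2 F f) (nf F f) = 0]) /\
  (forall e, enorm (te F e) = 1 /\
     exists c : R, te F e = c *: (p (tgt e) - p (src e))).

Definition outward (R : realType) (p : 'I_4 -> pt R) (F : frame R)
    (f : 'I_4) : pt R :=
  - Num.sg (dot (nf F f) (p f - p (lift f 0))) *: nf F f.

Definition face_center (R : realType) (p : 'I_4 -> pt R) (f : 'I_4) : pt R :=
  3^-1 *: \sum_(j < 3) p (lift f j).

(* Right-hand rule: t is positively oriented on the boundary of f when
   n_f x t points towards the interior of f. *)
Definition bdry_tangent (R : realType) (p : 'I_4 -> pt R) (F : frame R)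
    (f : 'I_4) (e : edge) : pt R :=
  Num.sg (dot (cross (nf F f) (te F e)) (face_center p f - p (src e))) *: te F e.

(* Outward direction, along e, at its end point p (tgt e); at p (src e) it is
   the opposite vector. *)
Definition edge_outward (R : realType) (p : 'I_4 -> pt R) (e : edge) : pt R :=
  (enorm (p (tgt e) - p (src e)))^-1 *: (p (tgt e) - p (src e)).

(* int_bdry_tetra p g = \int_(\partial T) g, the integrand on the face f
   being g f; similarly for the boundary of a face. *)
Definition int_bdry_tetra (R : realType) (p : 'I_4 -> pt R)
    (g : 'I_4 -> pt R -> R) : R :=
  \sum_(f < 4) int_face p f (g f).

Definition int_bdry_face (R : realType) (p : 'I_4 -> pt R) (f : 'I_4)
    (g : edge -> pt R -> R) : R :=
  \sum_(e : edge | edge_in e f) int_edge p e (g e).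

(* A function on D is encoded as its extension by 0 outside of D, so that
   equality of functions on D is plain equality.  [msize] is one more than the
   total degree. *)
Definition Pk (R : realType) (k : nat) (D : set (pt R)) : set (pt R -> R) :=
  [set u | exists2 q : mpoly.mpoly 3 R, (mpoly.msize q <= k.+1)%N &
     u = patch (fun=> 0) D (fun x => mpoly.meval (x 0) q)].

Definition Pk3 (R : realType) (k : nat) (D : set (pt R)) : set (pt R -> pt R) :=
  [set u | forall i : 'I_3, Pk k D (fun x => u x 0 i)].

Definition Pk_tan (R : realType) (k : nat) (D : set (pt R)) (t1 t2 : pt R) :
    set (pt R -> pt R) :=
  [set u | exists u1 u2, [/\ Pk k D u1, Pk k D u2 &
     u = fun x => u1 x *: t1 + u2 x *: t2]].

Definition Pk_dir (R : realType) (k : nat) (D : set (pt R)) (t : pt R) :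
    set (pt R -> pt R) :=
  [set u | exists2 v, Pk k D v & u = fun x => v x *: t].

Definition C1 (R : realType) : Type :=
  ((pt R -> R) * ('I_4 -> pt R -> R) * (edge -> pt R -> R) * ('I_4 -> R))%type.
Definition C2 (R : realType) : Type :=
  ((pt R -> pt R) * ('I_4 -> pt R -> pt R) * (edge -> pt R -> pt R))%type.
Definition C3 (R : realType) : Type :=
  ((pt R -> pt R) * ('I_4 -> pt R -> pt R))%type.
Definition C4 (R : realType) : Type := pt R -> R.

Definition V1 (R : realType) (k : nat) (p : 'I_4 -> pt R) : set (C1 R) :=
  [set v | let: (v0, vf, ve, vn) := v in
    [/\ Pk k (tetra p) v0, forall f, Pk k (face p f) (vf f)
      & forall e, Pk k (segment p e) (ve e)]].

Definition V2 (R : realType) (k : nat) (p : 'I_4 -> pt R) (F : frame R) :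
    set (C2 R) :=
  [set u | let: (u0, uf, ue) := u in
    [/\ Pk3 k (tetra p) u0,
        forall f, Pk_tan k (face p f) (tf1 F f) (tf2 F f) (uf f)
      & forall e, Pk_dir k (segment p e) (te F e) (ue e)]].

Definition V3 (R : realType) (k : nat) (p : 'I_4 -> pt R) (F : frame R) :
    set (C3 R) :=
  [set w | let: (w0, wf) := w in
    Pk3 k (tetra p) w0 /\
    forall f, Pk_dir k (face p f) (nf F f) (wf f)].

Definition V4 (R : realType) (k : nat) (p : 'I_4 -> pt R) : set (C4 R) :=
  Pk k (tetra p).

Definition Iw (R : realType) (p : 'I_4 -> pt R) (a : R * R * R * R) : C1 R :=
  let: (a1, a2, a3, a4) := a in
  (patch (fun=> 0) (tetra p) (fun=> a1),
   fun f => patch (fun=> 0) (face p f) (fun=> a2),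
   fun e => patch (fun=> 0) (segment p e) (fun=> a3),
   fun=> a4).

(* In the defining identities the test functions are polynomials on the whole
   space (D = setT): they can be differentiated, their restrictions exhaust the
   test space on D, and every term depends only on the restriction (on a face or
   an edge, only tangential derivatives occur). *)
Definition is_wgrad (R : realType) (k : nat) (p : 'I_4 -> pt R) (F : frame R)
    (v : C1 R) (g : C2 R) : Prop :=
  let: (v0, vf, ve, vn) := v in
  let: (g0, gf, ge) := g in
  [/\ V2 k p F g,
    forall phi, Pk3 k setT phi ->
      int_tetra p (fun x => dot (g0 x) (phi x)) =
      - int_tetra p (fun x => v0 x * div phi x)
      + int_bdry_tetra p (fun f x => vf f x * dot (phi x) (outward p F f)),
    forall f theta, Pk_tan k setT (tf1 F f) (tf2 F f) theta ->
      int_face p f (fun x => dot (gf f x) (cross (theta x) (nf F f))) =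
      - int_face p f (fun x => vf f x * dot (curl theta x) (nf F f))
      + int_bdry_face p f
          (fun e x => ve e x * dot (theta x) (bdry_tangent p F f e))
  & forall e phi, Pk k setT phi ->
      int_edge p e (fun x => dot (ge e x) (phi x *: te F e)) =
      - int_edge p e (fun x => ve e x * dot (grad phi x) (te F e))
      + (vn (tgt e) * (phi (p (tgt e)) * dot (te F e) (edge_outward p e))
         + vn (src e) * (phi (p (src e)) * dot (te F e) (- edge_outward p e)))].

Definition is_wcurl (R : realType) (k : nat) (p : 'I_4 -> pt R) (F : frame R)
    (u : C2 R) (w : C3 R) : Prop :=
  let: (u0, uf, ue) := u in
  let: (w0, wf) := w in
  [/\ V3 k p F w,
    forall theta, Pk3 k setT theta ->
      int_tetra p (fun x => dot (w0 x) (theta x)) =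
      int_tetra p (fun x => dot (u0 x) (curl theta x))
      + int_bdry_tetra p
          (fun f x => dot (uf f x) (cross (theta x) (outward p F f)))
  & forall f tau, Pk k setT tau ->
      int_face p f (fun x => dot (wf f x) (tau x *: nf F f)) =
      int_face p f (fun x => dot (uf f x) (cross (grad tau x) (nf F f)))
      + int_bdry_face p f
          (fun e x => dot (ue e x) (tau x *: bdry_tangent p F f e))].

Definition is_wdiv (R : realType) (k : nat) (p : 'I_4 -> pt R) (F : frame R)
    (w : C3 R) (d : C4 R) : Prop :=
  let: (w0, wf) := w in
  V4 k p d /\
  forall tau, Pk k setT tau ->
    int_tetra p (fun x => d x * tau x) =
    - int_tetra p (fun x => dot (w0 x) (grad tau x))
    + int_bdry_tetra p (fun f x => dot (wf f x) (tau x *: outward p F f)).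

(* The element determined by the defining identities, which have a unique
   solution by the Riesz representation theorem. *)
Definition wgrad (R : realType) (k : nat) (p : 'I_4 -> pt R) (F : frame R)
    (v : C1 R) : C2 R :=
  xget (0 : (pt R -> pt R) * ('I_4 -> pt R -> pt R) * (edge -> pt R -> pt R))
    (is_wgrad k p F v).

Definition wcurl (R : realType) (k : nat) (p : 'I_4 -> pt R) (F : frame R)
    (u : C2 R) : C3 R :=
  xget (0 : (pt R -> pt R) * ('I_4 -> pt R -> pt R)) (is_wcurl k p F u).

Definition wdiv (R : realType) (k : nat) (p : 'I_4 -> pt R) (F : frame R)
    (w : C3 R) : C4 R :=
  xget (0 : pt R -> R) (is_wdiv k p F w).

Definition Ker (S : Type) (W : nmodType) (V : set S) (A : S -> W) : set S :=
  [set v | V v /\ A v = 0].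

(* Main.v *)
Require Import Defs.
From HB Require Import structures.
From mathcomp Require Import all_boot all_order all_algebra.
From mathcomp Require Import all_classical all_reals all_analysis.
From mathcomp Require mpoly.
From mathcomp Require Import measurable_realfun ring lra.
Import Order.TTheory GRing.Theory Num.Theory.
Import numFieldNormedType.Exports.
Local Open Scope classical_set_scope.
Local Open Scope ring_scope.

Set Implicit Arguments.
Unset Strict Implicit.
Unset Printing Implicit Defensive.

(* For k = 0 all fields and test functions are constant, so the volume terms of
   the defining identities vanish and the weak operators become finite linear
   maps, which no longer see the interior component of their argument.  Let X_f
   be the cross product of the edge vectors at the first vertex of the face f,
   and E_e the vector of the edge e.  After the change of variables
   y_f = area * X_f x u_f (area of the reference triangle), z_e = u_e . E_e,
   om_f = area * w_f . X_f, all unit normals and tangents disappear and, up to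
   nonzero factors, the operators read
     grad (v0, vf, ve, vn) = (alt (vf X), bdry (ve E), vn (tgt e) - vn (src e)),
     curl (u0, y, z) = (alt y, bdry z),      div (w0, om) = alt om,
   where bdry and alt are the signed sums over the edges of a face and over the
   faces of the simplex.  Exactness is then simplicial (bdry and alt are
   boundary maps) together with the independence of the edge vectors at a
     vertex. *)

(** * Vertices, edges and faces of the simplex, and its signed incidence sums *)

Definition v0 : 'I_4 := @Ordinal 4 0 isT.
Definition v1 : 'I_4 := @Ordinal 4 1 isT.
Definition v2 : 'I_4 := @Ordinal 4 2 isT.
Definition v3 : 'I_4 := @Ordinal 4 3 isT.

Definition e01 : edge := exist _ (v0, v1) isT.
Definition e02 : edge := exist _ (v0, v2) isT.
Definition e03 : edge := exist _ (v0, v3) isT.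
Definition e12 : edge := exist _ (v1, v2) isT.
Definition e13 : edge := exist _ (v1, v3) isT.
Definition e23 : edge := exist _ (v2, v3) isT.

Lemma ord3_ind (P : 'I_3 -> Prop) : P 0 -> P 1 -> P 2 -> forall i, P i.
Proof.
by move=> P0 P1 P2 [[|[|[|//]]] h]; [have -> : Ordinal h = 0|
  have -> : Ordinal h = 1|have -> : Ordinal h = 2]; rewrite //; apply/val_inj.
Qed.

Lemma ord4_ind (P : 'I_4 -> Prop) :
  P v0 -> P v1 -> P v2 -> P v3 -> forall i, P i.
Proof.
by move=> P0 P1 P2 P3 [[|[|[|[|//]]]] h]; [have -> : Ordinal h = v0|
  have -> : Ordinal h = v1|have -> : Ordinal h = v2|have -> : Ordinal h = v3];
  rewrite //; apply/val_inj.
Qed.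

Lemma edge_ind (P : edge -> Prop) :
  P e01 -> P e02 -> P e03 -> P e12 -> P e13 -> P e23 -> forall e, P e.
Proof.
move=> P01 P02 P03 P12 P13 P23 e.
have : e \in [:: e01; e02; e03; e12; e13; e23].
  rewrite !inE -!val_eqE; case: e => [[i j] h] /=.
  by move: i j h; apply: ord4_ind; apply: ord4_ind.
rewrite !inE.
by do 5![case/predU1P => [-> //|]]; move=> /eqP ->.
Qed.

Lemma sum_ord3 (V : nmodType) (G : 'I_3 -> V) : \sum_i G i = G 0 + G 1 + G 2.
Proof.
rewrite !big_ord_recl big_ord0 addr0 addrA.
by congr (_ + G _ + G _); apply/val_inj.
Qed.

Lemma sum_ord4 (V : nmodType) (G : 'I_4 -> V) :
  \sum_i G i = G v0 + G v1 + G v2 + G v3.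
Proof.
rewrite !big_ord_recl big_ord0 addr0 !addrA.
by congr (G _ + G _ + G _ + G _); apply/val_inj.
Qed.

Lemma sum_edge (V : nmodType) (P : pred edge) (G : edge -> V) :
  \sum_(e | P e) G e =
  \sum_(e <- [:: e01; e02; e03; e12; e13; e23] | P e) G e.
Proof.
rewrite (perm_big [:: e01; e02; e03; e12; e13; e23]) //.
apply: uniq_perm => //; first exact: index_enum_uniq.
by move=> e; rewrite mem_index_enum; elim/edge_ind: e.
Qed.

Lemma lift_v :
  ((lift v0 (0 : 'I_3) = v1) * (lift v0 (1 : 'I_3) = v2) *
   (lift v0 (2 : 'I_3) = v3) * (lift v1 (0 : 'I_3) = v0) *
   (lift v1 (1 : 'I_3) = v2) * (lift v1 (2 : 'I_3) = v3) *
   (lift v2 (0 : 'I_3) = v0) * (lift v2 (1 : 'I_3) = v1) *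
   (lift v2 (2 : 'I_3) = v3) * (lift v3 (0 : 'I_3) = v0) *
   (lift v3 (1 : 'I_3) = v1) * (lift v3 (2 : 'I_3) = v2))%type.
Proof. by do !split; apply/val_inj. Qed.

Lemma src_tgt :
  ((src e01 = v0) * (tgt e01 = v1) * (src e02 = v0) * (tgt e02 = v2) *
   (src e03 = v0) * (tgt e03 = v3) * (src e12 = v1) * (tgt e12 = v2) *
   (src e13 = v1) * (tgt e13 = v3) * (src e23 = v2) * (tgt e23 = v3))%type.
Proof. by do !split. Qed.

(** Simplicial coboundary: on a face with vertices a < b < c it is the value of [z] at ab, minus
    that at ac, plus that at bc. The values lie in any [zmodType] because scalars and vectors on the
    edges are both summed this way. *)
Definition bdry (V : zmodType) (z : edge -> V) (f : 'I_4) : V :=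
  match val f with
  | 0 => z e12 - z e13 + z e23
  | 1 => z e02 - z e03 + z e23
  | 2 => z e01 - z e03 + z e13
  | _ => z e01 - z e02 + z e12
  end.

(** Opposite of the simplicial coboundary of face values, whose usual sign at the face [f] is
    (-1)^f. *)
Definition alt (V : zmodType) (y : 'I_4 -> V) : V :=
  - y v0 + y v1 - y v2 + y v3.

(* In the boundary of a face whose vertices are listed in increasing order, the
   only negative edge is the one from the first to the last vertex. *)
Definition orient (R : realType) (f : 'I_4) (e : edge) : R :=
  if [|| (f == v0) && (e == e13), (f == v1) && (e == e03),
         (f == v2) && (e == e03) | (f == v3) && (e == e02)] then -1 else 1.

Lemma sum_edge_in (R : realType) (V : lmodType R) (f : 'I_4) (z : edge -> V) :
  \sum_(e | edge_in e f) orient R f e *: z e = bdry z f.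
Proof.
by rewrite sum_edge; elim/ord4_ind: f;
  rewrite /= /edge_in /orient /bdry !big_cons big_nil /= ?addr0 !scale1r
    scaleN1r addrA.
Qed.

(** * Vector algebra in three dimensions *)

Section Vectors.
Context {R : realType}.
Implicit Types u v w x y : pt R.

Lemma rV3P u v : u 0 0 = v 0 0 -> u 0 1 = v 0 1 -> u 0 2 = v 0 2 -> u = v.
Proof. by move=> h0 h1 h2; apply/rowP; elim/ord3_ind. Qed.

Lemma dotE u v : dot u v = u 0 0 * v 0 0 + u 0 1 * v 0 1 + u 0 2 * v 0 2.
Proof. exact: sum_ord3. Qed.

Lemma crossE u v :
  (cross u v 0 0 = u 0 1 * v 0 2 - u 0 2 * v 0 1) *
  (cross u v 0 1 = u 0 2 * v 0 0 - u 0 0 * v 0 2) *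
  (cross u v 0 2 = u 0 0 * v 0 1 - u 0 1 * v 0 0).
Proof.
rewrite /cross !mxE.
have -> : (1 + 1 : 'I_3) = 2 by apply/val_inj.
have -> : (1 + 2 : 'I_3) = 0 by apply/val_inj.
have -> : (2 + 1 : 'I_3) = 0 by apply/val_inj.
have -> : (2 + 2 : 'I_3) = 1 by apply/val_inj.
by rewrite !add0r.
Qed.

End Vectors.

Ltac vring := intros; try apply: rV3P;
  rewrite ?(dotE, crossE, mxE); ring.

Section VectorIdentities.
Context {R : realType}.
Implicit Types u v w x y : pt R.

Lemma sgr_sqr1 (t : R) : t ^+ 2 = 1 -> Num.sg t = t.
Proof. by move/eqP; rewrite sqrf_eq1 => /orP[] /eqP ->; rewrite ?sgrN sgr1. Qed.

Lemma sqr1_neq0 (t : R) : t ^+ 2 = 1 -> t != 0.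
Proof.
by move=> h; apply: contra_eq_neq h => ->; rewrite expr0n eq_sym oner_eq0.
Qed.

Lemma dotC u v : dot u v = dot v u. Proof. vring. Qed.
Lemma dotDl u v w : dot (u + v) w = dot u w + dot v w. Proof. vring. Qed.
Lemma dotDr u v w : dot w (u + v) = dot w u + dot w v. Proof. vring. Qed.
Lemma dotZl c u w : dot (c *: u) w = c * dot u w. Proof. vring. Qed.
Lemma dotZr c u w : dot w (c *: u) = c * dot w u. Proof. vring. Qed.
Lemma dotNr u w : dot w (- u) = - dot w u. Proof. vring. Qed.
Lemma dotBr u v w : dot w (u - v) = dot w u - dot w v. Proof. vring. Qed.
Lemma dot0l u : dot 0 u = 0. Proof. vring. Qed.
Lemma dot0r u : dot u 0 = 0. Proof. vring. Qed.
Lemma crossZr c u v : cross u (c *: v) = c *: cross u v. Proof. vring. Qed.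
Lemma crossZl c u v : cross (c *: u) v = c *: cross u v. Proof. vring. Qed.
Lemma cross0l u : cross 0 u = 0. Proof. vring. Qed.
Lemma cross0r u : cross u 0 = 0. Proof. vring. Qed.
Lemma dot_crossC u v w : dot (cross u v) w = dot u (cross v w).
Proof. vring. Qed.
Lemma dot_cross_rot u v w : dot u (cross v w) = dot v (cross w u).
Proof. vring. Qed.
Lemma dot_crossl u v : dot u (cross u v) = 0. Proof. vring. Qed.
Lemma cross_cross u v :
  cross u (cross u v) = dot u v *: u - dot u u *: v.
Proof. vring. Qed.

Lemma dotvv_ge0 u : 0 <= dot u u.
Proof. by rewrite dotE -!expr2 !addr_ge0 ?sqr_ge0. Qed.

Lemma dotvv_eq0 u : dot u u = 0 -> u = 0.
Proof.
rewrite dotE -!expr2 => /eqP.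
rewrite !paddr_eq0 ?addr_ge0 ?sqr_ge0 // !sqrf_eq0 -andbA.
by case/and3P=> /eqP h0 /eqP h1 /eqP h2; apply: rV3P; rewrite ?h0 ?h1 ?h2 mxE.
Qed.

Lemma dotvv_gt0 u : u != 0 -> 0 < dot u u.
Proof.
move=> u0; rewrite lt_def dotvv_ge0 andbT.
by apply: contra u0 => /eqP /dotvv_eq0 /eqP.
Qed.

Lemma dot_ext u v : (forall w, dot u w = dot v w) -> u = v.
Proof.
move=> h; apply/eqP; rewrite -subr_eq0; apply/eqP/dotvv_eq0.
have := h (u - v); rewrite !(dotC _ (u - v)) => h'.
by rewrite dotBr h' subrr.
Qed.

Lemma enorm_gt0 u : u != 0 -> 0 < enorm u.
Proof. by move=> u0; rewrite sqrtr_gt0 dotvv_gt0. Qed.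

Lemma enorm_sqr u : enorm u ^+ 2 = dot u u.
Proof. by rewrite sqr_sqrtr // dotvv_ge0. Qed.

(** As [u] is orthogonal to [b] and [c], its cross product with [cross b c] vanishes, so the double
    product formula makes [cross b c] a multiple of [u]. The sign [s] stays unspecified. *)
Lemma unit_normal u b c : enorm u = 1 -> dot u b = 0 -> dot u c = 0 ->
  cross b c != 0 ->
  exists2 s : R, s ^+ 2 = 1 & enorm (cross b c) *: u = s *: cross b c.
Proof.
move=> u1 ub uc X0.
have uu : dot u u = 1 by rewrite -enorm_sqr u1 expr1n.
have L0 := enorm_gt0 X0.
have hX : cross b c = dot u (cross b c) *: u.
  have : cross u (cross u (cross b c)) = 0.
    have -> : cross u (cross b c) = dot u c *: b - dot u b *: c by vring.
    by rewrite ub uc !scale0r subrr cross0r.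
  by rewrite cross_cross uu scale1r => /subr0_eq/esym.
set d := dot u _ in hX.
have Ld : enorm (cross b c) ^+ 2 = d ^+ 2.
  by rewrite enorm_sqr hX dotZl dotZr uu mulr1.
exists (d / enorm (cross b c)).
  by rewrite expr_div_n -Ld divff // expf_neq0 ?gt_eqF.
apply: (@etrans _ _ ((d / enorm (cross b c) * d) *: u)); last first.
  by rewrite -scalerA -hX.
congr (_ *: _).
by apply: (mulIf (lt0r_neq0 L0)); rewrite -expr2 Ld; field; rewrite gt_eqF.
Qed.

Lemma unit_parallel u b c : enorm u = 1 -> u = c *: b -> b != 0 ->
  exists2 s : R, s ^+ 2 = 1 & enorm b *: u = s *: b.
Proof.
move=> u1 uE b0; exists (enorm b * c); last by rewrite uE scalerA.
have : enorm u ^+ 2 = 1 by rewrite u1 expr1n.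
by rewrite enorm_sqr uE dotZl dotZr mulrA -expr2 exprMn enorm_sqr mulrC.
Qed.

(** The matrix with rows [t1], [t2], [n] is orthogonal, so its transpose is an inverse on both
    sides; this expands [u], and the component along [n] vanishes. *)
Lemma orthonormal_frame t1 t2 n u :
  enorm t1 = 1 -> enorm t2 = 1 -> enorm n = 1 ->
  dot t1 t2 = 0 -> dot t1 n = 0 -> dot t2 n = 0 -> dot n u = 0 ->
  u = dot t1 u *: t1 + dot t2 u *: t2.
Proof.
move=> h1 h2 h3 h12 h13 h23 hu.
have d1 : dot t1 t1 = 1 by rewrite -enorm_sqr h1 expr1n.
have d2 : dot t2 t2 = 1 by rewrite -enorm_sqr h2 expr1n.
have d3 : dot n n = 1 by rewrite -enorm_sqr h3 expr1n.
pose M : 'M[R]_3 := \matrix_i (nth t1 [:: t1; t2; n] i).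
have MM : M *m M^T = 1%:M.
  apply/matrixP => i j; rewrite !mxE.
  have -> : \sum_k M i k * M^T k j =
    dot (nth t1 [:: t1; t2; n] i) (nth t1 [:: t1; t2; n] j).
    by apply: eq_bigr => k _; rewrite !mxE.
  elim/ord3_ind: i; elim/ord3_ind: j => /=;
    by rewrite ?(dotC t2 t1) ?(dotC n) ?d1 ?d2 ?d3 ?h12 ?h13 ?h23.
have MM' := mulmx1C MM.
have : u *m M^T *m M = u by rewrite -mulmxA MM' mulmx1.
move=> <-; apply/rowP => i; rewrite !mxE sum_ord3 !mxE /=.
have d n' : \sum_j u 0 j * M^T j n' = dot (nth t1 [:: t1; t2; n] n') u.
  by rewrite dotC; apply: eq_bigr => k _; rewrite !mxE.
by rewrite !d /= hu mul0r addr0 -mulmxA MM' mulmx1.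
Qed.

End VectorIdentities.

(** * Volume of the tetrahedron *)

Section ReferenceMeasures.
Context {R : realType}.
Implicit Type p : 'I_4 -> pt R.

Notation mu1 := (@lebesgue_measure R).
Notation mu2 := (mu1 \x mu1)%E.
Notation mu3 := (mu1 \x mu1 \x mu1)%E.

Definition ref_triangle : set (R * R) :=
  [set q : R * R | [/\ 0 <= q.1, 0 <= q.2 & q.1 + q.2 <= 1]].

Definition xyz (q : R * R * R) : pt R := \row_(i < 3) [:: q.1.1; q.1.2; q.2]`_i.

Definition area : R := fine (mu2 ref_triangle).
Definition vol (p : 'I_4 -> pt R) : R := fine (mu3 (xyz @^-1` tetra p)).

Lemma measurable_ge0 d (T : measurableType d) (f : T -> R) :
  measurable_fun setT f -> measurable [set x | 0 <= f x].
Proof.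
move=> mf; rewrite -[X in measurable X]setTI.
have -> : [set x | 0 <= f x] = f @^-1` `[0, +oo[%classic.
  by apply/seteqP; split => x /=; rewrite in_itv /= andbT.
exact: mf.
Qed.

(** Sandwiching gives positivity without computing a measure. The finite bound on [C] matters
    because [fine] sends an infinite measure to 0. *)
Lemma fine_measure_gt0 d (T : measurableType d) (m : {measure set T -> \bar R})
    (A B C : set T) :
  measurable A -> measurable B -> measurable C -> A `<=` B -> B `<=` C ->
  (0 < m A)%E -> (m C < +oo)%E -> 0 < fine (m B).
Proof.
move=> mA mB mC AB BC A0 Coo; apply: fine_gt0; apply/andP; split.
- by apply: (lt_le_trans A0); apply: le_measure; rewrite ?inE.
- by apply: le_lt_trans Coo; apply: le_measure; rewrite ?inE.
Qed.

Lemma measurable_ref_triangle : measurable ref_triangle.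
Proof.
have -> : ref_triangle = [set q | 0 <= q.1] `&` [set q | 0 <= q.2] `&`
    [set q : R * R | 0 <= 1 - (q.1 + q.2)].
  apply/seteqP; split => [q [h1 h2 h3]|q [[h1 h2] /= h3]].
    by do !split => //=; rewrite subr_ge0.
  by split => //; rewrite -subr_ge0.
do 2?apply: measurableI; apply: measurable_ge0.
- exact: measurable_fst.
- exact: measurable_snd.
- apply: measurable_funB => //; apply: measurable_funD.
  + exact: measurable_fst.
  + exact: measurable_snd.
Qed.

Lemma lebesgue_itv (a b : R) : a < b ->
  mu1 `[a, b]%classic = (b - a)%:E.
Proof. by move=> ab; rewrite lebesgue_measure_itv /= lte_fin ab. Qed.

Lemma mu2_box (a1 b1 a2 b2 : R) : a1 < b1 -> a2 < b2 ->
  mu2 (`[a1, b1]%classic `*` `[a2, b2]%classic) = ((b1 - a1) * (b2 - a2))%:E.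
Proof. by move=> h1 h2; rewrite product_measure1E //= !lebesgue_itv // EFinM.
  Qed.

Lemma mu3_box (a1 b1 a2 b2 a3 b3 : R) : a1 < b1 -> a2 < b2 -> a3 < b3 ->
  mu3 (`[a1, b1]%classic `*` `[a2, b2]%classic `*` `[a3, b3]%classic) =
  ((b1 - a1) * (b2 - a2) * (b3 - a3))%:E.
Proof.
move=> h1 h2 h3; rewrite product_measure1E //=; last exact: measurableX.
by rewrite product_measure1E //= !lebesgue_itv // !EFinM.
Qed.

Lemma area_gt0 : 0 < area.
Proof.
(* The triangle contains the square of side 1/2 at the origin and lies in the unit square. *)
apply: (@fine_measure_gt0 _ _ mu2 (`[0, 2^-1]%classic `*` `[0, 2^-1]%classic) _
  (`[0, 1]%classic `*` `[0, 1]%classic)).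
- by apply: measurableX.
- exact: measurable_ref_triangle.
- by apply: measurableX.
- move=> [x y] [] /=; rewrite !in_itv /= => /andP[h1 h2] /andP[h3 h4].
  by split => //=; lra.
- move=> [x y] [] /= h1 h2 h3; rewrite !in_itv /=; split; apply/andP; split;
    lra.
- by rewrite [X in (_ < X)%E]mu2_box ?lte_fin; lra.
- by rewrite [X in (X < _)%E]mu2_box ?ltry //; lra.
Qed.



(** Six times the signed volume of the tetrahedron; the sign records the orientation of the vertex
    order. *)
Definition det3 (p : 'I_4 -> pt R) : R :=
  dot (p v1 - p v0) (cross (p v2 - p v0) (p v3 - p v0)).

(** Let [a], [b], [c] be the edge vectors at [p v0]. If their triple product vanishes, [cross a b]
    is orthogonal to all three, hence zero. Then [cross b (cross a b)] is a vanishing combination of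
    [a] and [b], in which [a] has the coefficient [dot b b]; so [b] is zero, against
    independence. *)
Lemma det3_neq0 p : nondegenerate_tetra p -> det3 p != 0.
Proof.
rewrite /nondegenerate_tetra /det3; set A := \matrix_j _ => Afree.
set a := _ - _; set b := _ - _; set c := _ - _.
have rowA (u : pt R) : u *m A = u 0 0 *: a + u 0 1 *: b + u 0 2 *: c.
  apply/rowP => i; rewrite !mxE sum_ord3 !mxE.
  have -> : lift ord0 (0 : 'I_3) = v1 by apply/val_inj.
  have -> : lift ord0 (1 : 'I_3) = v2 by apply/val_inj.
  have -> : lift ord0 (2 : 'I_3) = v3 by apply/val_inj.
  by have -> : ord0 = v0 by apply/val_inj.
have inj (u : pt R) : u *m A = 0 -> u = 0.
  by move=> h; apply: (row_free_inj Afree); rewrite h mul0mx.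
apply/eqP => D0.
have ab0 : cross a b = 0.
  have /row_free_inj : row_free A^T by rewrite row_free_unit unitmx_tr
    -row_free_unit.
  apply; rewrite mul0mx; apply/rowP => i; rewrite [RHS]mxE.
  transitivity (dot (cross a b) (delta_mx 0 i *m A)).
    rewrite -rowE !mxE; apply: eq_bigr => j _; rewrite !mxE; congr (_ * _).
  rewrite rowA; elim/ord3_ind: i; rewrite !mxE /= ?scale1r ?scale0r ?add0r
    ?addr0.
  - vring.
  - vring.
  - by rewrite dot_crossC.
have b0 : b = 0.
  apply: dotvv_eq0.
  have : (dot b b *: delta_mx 0 0 - dot a b *: delta_mx 0 1 : pt R) *m A = 0.
    rewrite rowA !mxE /= !(mulr1, mulr0, subr0, sub0r) scale0r addr0.
    have -> : dot b b *: a + - dot a b *: b = cross b (cross a b) by vring.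
    by rewrite ab0 cross0r.
  by move/inj/rowP/(_ 0); rewrite !mxE /= mulr1 mulr0 subr0.
have : (delta_mx 0 1 : pt R) *m A = 0.
  by rewrite rowA !mxE /= !scale0r b0 scaler0 !addr0.
by move/inj/rowP/(_ 1); rewrite !mxE /= => /eqP; rewrite oner_eq0.
Qed.

(* The dual basis of the edge vectors at p v0, and the opposite of its sum. *)
Definition bary_grad (p : 'I_4 -> pt R) (i : 'I_4) : pt R :=
  let a := p v1 - p v0 in let b := p v2 - p v0 in let c := p v3 - p v0 in
  (det3 p)^-1 *: match val i with
  | 0 => - (cross b c + cross c a + cross a b)
  | 1 => cross b c
  | 2 => cross c a
  | _ => cross a b
  end.

(** Barycentric coordinate, as an affine function on the whole space; the constant term is 1 only
    for the vertex [p v0], the origin of the edge vectors. *)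
Definition bary (p : 'I_4 -> pt R) (i : 'I_4) (x : pt R) : R :=
  (val i == 0)%:R + dot (bary_grad p i) (x - p v0).

Lemma bary_comb p (l : 'I_4 -> R) i : nondegenerate_tetra p ->
  \sum_j l j = 1 -> bary p i (\sum_j l j *: p j) = l i.
Proof.
move=> /det3_neq0 D0 l1; rewrite /bary.
  have -> : \sum_j l j *: p j - p v0 = l v1 *: (p v1 - p v0) +
      l v2 *: (p v2 - p v0) + l v3 *: (p v3 - p v0).
    rewrite sum_ord4; have -> : l v0 = 1 - l v1 - l v2 - l v3.
      by rewrite -l1 sum_ord4; ring.
    vring.
  rewrite /bary_grad; have := l1; rewrite sum_ord4 => {}l1.
  move: D0; rewrite /det3; set a := p v1 - _; set b := p v2 - _;
    set c := p v3 - _.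
  move=> D0; elim/ord4_ind: i => /=; rewrite dotZl.
  - have -> : l v0 = 1 - (l v1 + l v2 + l v3) by rewrite -l1; ring.
    congr (_ + _); apply: (mulfI D0); rewrite mulrA divff // mul1r.
    vring.
  - rewrite add0r; apply: (mulfI D0); rewrite mulrA divff // mul1r; vring.
  - rewrite add0r; apply: (mulfI D0); rewrite mulrA divff // mul1r; vring.
  - rewrite add0r; apply: (mulfI D0); rewrite mulrA divff // mul1r; vring.
Qed.

(** The barycentric coordinates of a point are its only possible weights, so the tetrahedron is an
    intersection of four half-spaces. Its measurability and the search for a box inside it use this
    form. *)
Lemma tetraP p : nondegenerate_tetra p -> forall x,
  tetra p x <-> forall i, 0 <= bary p i x.
Proof.
move=> ndp x; split.
  by case=> l [l0 _ l1 ->] i; rewrite bary_comb.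
have D0 := det3_neq0 ndp.
move=> h; exists (fun i => bary p i x); split => //.
- by move=> i; rewrite inE.
- rewrite sum_ord4 /bary /bary_grad /=.
  rewrite !dotZl; vring.
- rewrite sum_ord4 /bary /bary_grad /= !add0r !dotZl.
  move: D0; rewrite /det3; set a := p v1 - _; set b := p v2 - _;
    set c := p v3 - _.
  move=> D0; set y := x - p v0; have -> : x = p v0 + y by rewrite /y addrC
    subrK.
  have -> : p v1 = p v0 + a by rewrite /a addrC subrK.
  have -> : p v2 = p v0 + b by rewrite /b addrC subrK.
  have -> : p v3 = p v0 + c by rewrite /c addrC subrK.
  (* Cramer's rule: the expansion of [y] in the basis [a], [b], [c]. *)
  have key : dot a (cross b c) *: y = dot (cross b c) y *: a +
    dot (cross c a) y *: b + dot (cross a b) y *: c by vring.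
  have -> : dot (- (cross b c + cross c a + cross a b)) y =
    - (dot (cross b c) y + dot (cross c a) y + dot (cross a b) y) by vring.
  rewrite -[in LHS](scalerK D0 y) key; move: (_^-1) (dot _ y) (dot _ y) (dot _
    y).
  by clear; move: (p v0) a b c => o a b c; vring.
Qed.

Lemma measurable_tetra p : nondegenerate_tetra p ->
  measurable (xyz @^-1` tetra p).
Proof.
move=> ndp.
have mb i : measurable [set q | 0 <= bary p i (xyz q)].
  apply: measurable_ge0; apply: measurable_funD => //.
  under eq_fun do rewrite dotE !mxE /=.
  have m1 : measurable_fun setT (fun q : R * R * R => q.1.1).
    by apply: measurableT_comp => //; exact: measurable_fst.
  have m2 : measurable_fun setT (fun q : R * R * R => q.1.2).
    by apply: measurableT_comp => //; exact: measurable_snd.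
  by do 2?apply: measurable_funD; apply: measurable_funM => //;
    apply: measurable_funB.
have -> : xyz @^-1` tetra p = [set q | 0 <= bary p v0 (xyz q)] `&`
   [set q | 0 <= bary p v1 (xyz q)] `&` [set q | 0 <= bary p v2 (xyz q)] `&`
   [set q | 0 <= bary p v3 (xyz q)].
  apply/seteqP; split => q /=; rewrite tetraP //.
  by move=> [[[h0 h1] h2] h3]; apply: ord4_ind.
by do 3?apply: measurableI; exact: mb.
Qed.

Lemma norm_coord_tetra p x j : tetra p x -> `|x 0 j| <= \sum_i `|p i 0 j|.
Proof.
case=> l [l0 _ l1 ->]; rewrite summxE.
apply: (le_trans (ler_norm_sum _ _ _)); apply: ler_sum => i _.
rewrite mxE normrM ger0_norm // ler_piMl //.
by rewrite -l1 (bigD1 i) //= lerDl sumr_ge0.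
Qed.

Lemma dot_le_box (g u : pt R) d : (forall j, `|u 0 j| <= d) ->
  `|dot g u| <= (\sum_j `|g 0 j|) * d.
Proof.
move=> h; apply: (le_trans (ler_norm_sum _ _ _)); rewrite mulr_suml.
by apply: ler_sum => i _; rewrite normrM ler_wpM2l.
Qed.

(** All barycentric coordinates are 1/4 at the centroid, so a cube around it lies inside as soon as
    none of them varies by more than 1/4 there. A box bounding the vertices lies outside. *)
Lemma vol_gt0 p : nondegenerate_tetra p -> 0 < vol p.
Proof.
move=> ndp.
pose m : pt R := \sum_i 4^-1 *: p i.
have bm i : bary p i m = 4^-1.
  by rewrite (bary_comb (l := fun=> 4^-1)) // sum_ord4; lra.
pose K : R := \sum_i \sum_j `|bary_grad p i 0 j|.
have K0 : 0 <= K by apply: sumr_ge0 => i _; apply: sumr_ge0.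
(* [K] bounds the variation of every barycentric coordinate per unit of half-side; the added 1 keeps
   the denominator positive. *)
pose d := (4 * (1 + K))^-1.
have d0 : 0 < d by rewrite invr_gt0; lra.
have Kd : K * d <= 4^-1.
  rewrite /d ler_pdivrMr; last by lra.
  lra.
(* The added 1 makes the outer box nondegenerate in every direction, as [mu3_box] requires. *)
pose M j : R := 1 + \sum_i `|p i 0 j|.
have M0 j : 0 < M j by rewrite ltr_pwDl // sumr_ge0.
apply: (@fine_measure_gt0 _ _ mu3
  (`[m 0 0 - d, m 0 0 + d]%classic `*` `[m 0 1 - d, m 0 1 + d]%classic
   `*` `[m 0 2 - d, m 0 2 + d]%classic) _
  (`[- M 0, M 0]%classic `*` `[- M 1, M 1]%classic `*` `[- M 2, M 2]%classic)).
- by do 2?apply: measurableX.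
- exact: measurable_tetra.
- by do 2?apply: measurableX.
- move=> [[x y] z] [] [] /=; rewrite !in_itv /= -!ler_distlC => hx hy hz.
  apply/(tetraP ndp) => i.
  set q := xyz _.
  have -> : bary p i q = bary p i m + dot (bary_grad p i) (q - m).
    by rewrite /bary; vring.
  have : `|dot (bary_grad p i) (q - m)| <= 4^-1.
    apply: le_trans Kd.
    apply: (le_trans (dot_le_box (d := d) _ _)).
      by elim/ord3_ind; rewrite !mxE distrC.
    apply: ler_wpM2r; first exact: ltW.
    rewrite /K [leRHS](bigD1 i) //= lerDl.
    by apply: sumr_ge0 => k _; apply: sumr_ge0.
  by rewrite bm ler_norml => /andP[+ _]; lra.
- move=> [[x y] z] /= h.
  have hM j : - M j <= xyz (x, y, z) 0 j <= M j.
    rewrite -ler_norml; apply: (le_trans (norm_coord_tetra j h)).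
    by rewrite lerDr.
  move: (hM 0) (hM 1) (hM 2); rewrite !mxE /= => h0 h1 h2.
  by rewrite !in_itv.
- rewrite [X in (_ < X)%E]mu3_box ?lte_fin; try lra.
  by rewrite !mulr_gt0 //; lra.
- by rewrite [X in (X < _)%E]mu3_box ?ltry // gtrN.
Qed.

End ReferenceMeasures.

(** * Piecewise constant fields *)

Section PiecewiseConstants.
Context {R : realType}.
Implicit Types (p : 'I_4 -> pt R) (D : set (pt R)).

Definition cst_on (V : zmodType) D (c : V) : pt R -> V :=
  patch (fun=> 0) D (fun=> c).

Lemma cst_onT (V : zmodType) (c : V) : cst_on setT c = fun=> c.
Proof. by apply/funext => x; rewrite /cst_on patchT // inE. Qed.

Lemma cst_onE (V : zmodType) D (c : V) x : D x -> cst_on D c x = c.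
Proof. by move=> Dx; rewrite /cst_on patchT // inE. Qed.

Lemma cst_on0 (V : zmodType) D : cst_on D (0 : V) = fun=> 0.
Proof. by apply/funext => x; rewrite /cst_on /patch; case: ifP. Qed.

Lemma cst_on_inj (V : zmodType) D (c c' : V) : D !=set0 ->
  cst_on D c = cst_on D c' -> c = c'.
Proof. by case=> x Dx /(congr1 (@^~ x)); rewrite !cst_onE. Qed.

Lemma Pk0P D u : Pk 0 D u <-> exists c, u = cst_on D c.
Proof.
split=> [[q /mpoly.msize1_polyC -> ->]|[c ->]].
  eexists; rewrite /cst_on; congr patch; apply/funext => x.
  exact: mpoly.mevalC.
exists (mpoly.mpolyC 3 c); first by rewrite mpoly.msizeC; case: (c != 0).
by congr patch; apply/funext => x; rewrite mpoly.mevalC.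
Qed.

Lemma Pk3_0P D u : Pk3 0 D u <-> exists c, u = cst_on D c.
Proof.
split=> [h|[c ->] i]; last first.
  apply/Pk0P; exists (c 0 i); apply/funext => x.
  by rewrite /cst_on /patch; case: ifP => _ //; rewrite mxE.
have [c hc] := choice (fun i => (Pk0P _ _).1 (h i)).
exists (\row_i c i); apply/funext => x; apply/rowP => i.
have := congr1 (@^~ x) (hc i); rewrite /= => ->.
by rewrite /cst_on /patch; case: ifP => _; rewrite mxE.
Qed.

Lemma Pk_dir0P D t u : Pk_dir 0 D t u <-> exists a, u = cst_on D (a *: t).
Proof.
have E a : (fun x => cst_on D a x *: t) = cst_on D (a *: t).
  by apply/funext => x; rewrite /cst_on /patch; case: ifP => //;
    rewrite scale0r.
split=> [[_ /Pk0P [a ->] ->]|[a ->]]; first by exists a.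
by exists (cst_on D a); [apply/Pk0P; exists a|rewrite E].
Qed.

Lemma Pk_tan0P D t1 t2 u :
  Pk_tan 0 D t1 t2 u <-> exists a b, u = cst_on D (a *: t1 + b *: t2).
Proof.
have E a b : (fun x => cst_on D a x *: t1 + cst_on D b x *: t2) =
    cst_on D (a *: t1 + b *: t2).
  apply/funext => x; rewrite /cst_on /patch; case: ifP => //.
  by rewrite !scale0r addr0.
split=> [[_ [_ [/Pk0P [a ->] /Pk0P [b ->] ->]]]|[a [b ->]]].
  by exists a, b.
by exists (cst_on D a), (cst_on D b); rewrite E; split=> //; apply/Pk0P;
  [exists a|exists b].
Qed.

Lemma partial_cst i (c : R) x : partial i (fun=> c) x = 0.
Proof. exact: derive_cst. Qed.

Lemma grad_cst (c : R) x : grad (fun=> c) x = 0.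
Proof. by apply/rowP => i; rewrite !mxE partial_cst. Qed.

Lemma div_cst (c : pt R) x : div (fun=> c) x = 0.
Proof. by rewrite /div big1 // => i _; rewrite partial_cst. Qed.

Lemma curl_cst (c : pt R) x : curl (fun=> c) x = 0.
Proof. by apply/rowP => i; rewrite !mxE !partial_cst subr0. Qed.

Definition face_vec p (f : 'I_4) : pt R :=
  cross (p (lift f 1) - p (lift f 0)) (p (lift f 2) - p (lift f 0)).

Definition edge_vec p (e : edge) : pt R := p (tgt e) - p (src e).

Lemma int_tetra_cst p g c : nondegenerate_tetra p ->
  (forall x, tetra p x -> g x = c) -> int_tetra p g = vol p * c.
Proof.
move=> ndp hg; rewrite /int_tetra /vol -/(@xyz R).
rewrite (@eq_Rintegral _ _ _ _ _ (fun=> c)); last first.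
  by move=> q; rewrite inE /= => /hg.
by rewrite Rintegral_cst; [rewrite mulrC|exact: measurable_tetra].
Qed.

Lemma face_param p f (s t : R) : 0 <= s -> 0 <= t -> s + t <= 1 ->
  face p f (p (lift f 0) + s *: (p (lift f 1) - p (lift f 0))
                         + t *: (p (lift f 2) - p (lift f 0))).
Proof.
move=> s0 t0 st.
exists (fun i => (i == lift f 0)%:R * (1 - s - t) + (i == lift f 1)%:R * s
                 + (i == lift f 2)%:R * t); split.
- move=> i; rewrite !addr_ge0 // mulr_ge0 //; lra.
- move=> i; rewrite !inE negbK => /eqP ->.
  by rewrite !(negbTE (neq_lift _ _)) !mul0r !addr0.
- by rewrite sum_ord4; elim/ord4_ind: f; rewrite !lift_v /=; ring.
- by rewrite sum_ord4; elim/ord4_ind: f; rewrite !lift_v /=; vring.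
Qed.

Lemma int_face_cst p f g c : (forall x, face p f x -> g x = c) ->
  int_face p f g = area * enorm (face_vec p f) * c.
Proof.
move=> hg; rewrite /int_face -/(face_vec p f).
rewrite (@eq_Rintegral _ _ _ _ _ (fun=> c)); last first.
  move=> q; rewrite inE /= => -[h1 h2 h3]; apply: hg; exact: face_param.
rewrite Rintegral_cst; last exact: measurable_ref_triangle.
by rewrite -/area; ring.
Qed.

Lemma segment_param p e (s : R) : 0 <= s <= 1 ->
  segment p e (p (src e) + s *: edge_vec p e).
Proof.
move=> /andP[s0 s1].
exists (fun i => (i == src e)%:R * (1 - s) + (i == tgt e)%:R * s); split.
- move=> i; rewrite !addr_ge0 // mulr_ge0 //; lra.
- by move=> i; rewrite !inE negb_or => /andP[/negbTE -> /negbTE ->];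
    rewrite !mul0r addr0.
- by rewrite sum_ord4; elim/edge_ind: e; rewrite !src_tgt /=; ring.
- by rewrite sum_ord4 /edge_vec; elim/edge_ind: e; rewrite !src_tgt /=; vring.
Qed.

Lemma int_edge_cst p e g c : (forall x, segment p e x -> g x = c) ->
  int_edge p e g = enorm (edge_vec p e) * c.
Proof.
move=> hg; rewrite /int_edge -/(edge_vec p e).
rewrite (@eq_Rintegral _ _ _ _ _ (fun=> c)); last first.
  move=> s; rewrite inE /= in_itv /= => s01; apply: hg; exact: segment_param.
by rewrite Rintegral_cst // [X in fine X]lebesgue_itv //= subr0 mulr1.
Qed.

Lemma tetra_neq0 p : tetra p !=set0.
Proof.
exists (p v0); exists (fun i => (i == v0)%:R); split => //.
- by move=> i; rewrite inE.
- by rewrite sum_ord4 /=; ring.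
- by rewrite sum_ord4 /=; vring.
Qed.

Lemma face_neq0 p f : face p f !=set0.
Proof. by eexists; apply: (@face_param _ _ 0 0); rewrite ?addr0 ?ler01. Qed.

Lemma segment_neq0 p e : segment p e !=set0.
Proof. by eexists; apply: (@segment_param _ _ 0); rewrite lexx ler01. Qed.

End PiecewiseConstants.

(** * Normals, tangents and orientations *)

Section Geometry.
Context {R : realType}.
Variables (p : 'I_4 -> pt R) (F : frame R).
Hypotheses (ndp : nondegenerate_tetra p) (hF : is_frame p F).

Notation X := (face_vec p).
Notation E := (edge_vec p).

Definition eps (f : 'I_4) : R := if (f == v0) || (f == v2) then -1 else 1.

Lemma sum_eps (V : lmodType R) (y : 'I_4 -> V) : \sum_f eps f *: y f = alt y.
Proof. by rewrite sum_ord4 /eps /= !scaleN1r !scale1r. Qed.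

(** Both sides are triple products of the same four vertices in two orders, and [eps f] is the sign
    of the reordering. Thus [eps f * det3 p] tells to which side of the face the vector [X f]
    points. *)
Lemma face_vec_opposite f : dot (X f) (p f - p (lift f 0)) = eps f * det3 p.
Proof.
rewrite /face_vec /det3 /eps; elim/ord4_ind: f; rewrite !lift_v /=; vring.
Qed.

Lemma face_vec_neq0 f : X f != 0.
Proof.
apply: contra (det3_neq0 ndp) => /eqP X0.
have := face_vec_opposite f; rewrite X0 dot0l => /esym/eqP.
by rewrite mulf_eq0 /eps; case: ifP; rewrite ?oppr_eq0 oner_eq0.
Qed.

(** A null edge would make the cross product [X f] vanish for any face containing it. *)
Lemma edge_vec_neq0 e : E e != 0.
Proof.
have XE f : edge_in e f -> E e = 0 -> X f = 0.
  rewrite /edge_vec /face_vec /edge_in; elim/edge_ind: e; elim/ord4_ind: f;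
  rewrite ?lift_v ?src_tgt //= => _ /subr0_eq ->; vring.
have [f fe] : exists f, edge_in e f.
  by elim/edge_ind: e {XE}; (exists v0 + exists v1 + exists v2).
by apply/eqP => /(XE f fe) /eqP; rewrite (negbTE (face_vec_neq0 f)).
Qed.

Lemma dot_face_edge f e : edge_in e f -> dot (X f) (E e) = 0.
Proof.
rewrite /edge_vec /face_vec /edge_in; elim/edge_ind: e; elim/ord4_ind: f;
  rewrite ?lift_v ?src_tgt //= => _; vring.
Qed.

(** The frame fixes [nf F f] only up to the sign [s]; since [s ^+ 2 = 1], this sign can be cancelled
    from the identities that it multiplies. *)
Lemma nfE f : exists2 s : R, s ^+ 2 = 1 & enorm (X f) *: nf F f = s *: X f.
Proof.
have [/(_ f)[n1 no] _] := hF.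
by apply: unit_normal => //; rewrite ?no //; exact: face_vec_neq0.
Qed.

Lemma teE e : exists2 s : R, s ^+ 2 = 1 & enorm (E e) *: te F e = s *: E e.
Proof.
have [_ [_ /(_ e)[t1 [c tE]]]] := hF.
by apply: (unit_parallel t1 tE); exact: edge_vec_neq0.
Qed.

Lemma dot_nf_eq0 f u : (dot (nf F f) u == 0) = (dot (X f) u == 0).
Proof.
have [s s1 h] := nfE f; have X0 := enorm_gt0 (face_vec_neq0 f).
have s0 := sqr1_neq0 s1.
have := congr1 (fun x : pt R => dot x u) h; rewrite !dotZl => {}h.
by rewrite -[RHS](mulrI_eq0 _ (mulfI s0)) -h mulrI_eq0 //; apply/mulfI;
  rewrite gt_eqF.
Qed.

(** The unknown sign of [nf F f] enters [outward] twice, through the vector and through [Num.sg],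
    and cancels. What remains is fixed by the orientation of the vertices. *)
Lemma scale_outward f :
  enorm (X f) *: outward p F f = (- Num.sg (det3 p) * eps f) *: X f.
Proof.
have [s s1 h] := nfE f; have X0 := enorm_gt0 (face_vec_neq0 f).
rewrite /outward scalerA [enorm _ * _]mulrC -[LHS]scalerA h scalerA.
congr (_ *: _).
suff -> : Num.sg (dot (nf F f) (p f - p (lift f 0))) =
    s * (eps f * Num.sg (det3 p)).
  rewrite mulNr mulrAC -expr2 s1; ring.
rewrite -[LHS]mul1r -(gtr0_sg X0) -sgrM -dotZl h dotZl face_vec_opposite.
by rewrite !sgrM (sgr_sqr1 (t := s)) // (sgr_sqr1 (t := eps f)) // /eps;
  case: ifP; rewrite ?sqrrN expr1n.
Qed.

(** The sign of [te F e] occurs twice and cancels, whereas that of [nf F f] survives through the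
    right-hand rule. Hence [s] is an argument: it has to be the same sign as on the other side of
    the face identities. *)
Lemma scale_bdry_tangent f e (s : R) : s ^+ 2 = 1 ->
  enorm (X f) *: nf F f = s *: X f -> edge_in e f ->
  enorm (E e) *: bdry_tangent p F f e = (s * orient R f e) *: E e.
Proof.
move=> s1 h fe; have X0 := enorm_gt0 (face_vec_neq0 f).
have [t t1 ht] := teE e; have E0 := enorm_gt0 (edge_vec_neq0 e).
rewrite /bdry_tangent scalerA [enorm _ * _]mulrC -[LHS]scalerA ht scalerA;
  congr (_ *: _).
suff -> : Num.sg (dot (cross (nf F f) (te F e)) (face_center p f - p (src e))) =
    s * t * orient R f e.
  by rewrite -!mulrA (mulrC _ t) !mulrA -(mulrA s t t) -expr2 t1; ring.
rewrite -[LHS]mul1r -(gtr0_sg X0) -[LHS]mul1r -(gtr0_sg E0) -!sgrM -!dotZl.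
rewrite -crossZl h -crossZr ht crossZl crossZr !dotZl.
(* The centroid of a face is at one third of the height over each edge, whence the factor 1/3;
   [orient] records on which side of the edge the face lies. *)
have -> : dot (cross (X f) (E e)) (face_center p f - p (src e)) =
    orient R f e * (3^-1 * dot (X f) (X f)).
  rewrite /face_center sum_ord3 /edge_vec /face_vec /orient;
    move: fe {h ht X0 E0}.
  elim/edge_ind: e; elim/ord4_ind: f; rewrite /edge_in ?lift_v ?src_tgt //= =>
    _;
    by rewrite ?(dotE, crossE, mxE); field.
rewrite !sgrM (sgr_sqr1 (t := s)) // (sgr_sqr1 (t := t)) // (sgr_sqr1 (t :=
  orient R f e)); last first.
  by rewrite /orient; case: ifP; rewrite ?sqrrN expr1n.
rewrite (gtr0_sg (dotvv_gt0 (face_vec_neq0 f))) gtr0_sg ?invr_gt0 ?ltr0n //.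
by rewrite !mulr1 mulrA.
Qed.

End Geometry.

(** * Coordinates on piecewise constant fields that do not involve unit normals and tangents *)

Section Coordinates.
Context {R : realType}.
Variables (p : 'I_4 -> pt R) (F : frame R).
Hypotheses (ndp : nondegenerate_tetra p) (hF : is_frame p F).

Notation X := (face_vec p).
Notation E := (edge_vec p).

(* face_field and face_flux invert the changes of variables
   u |-> area *: cross (X f) u and w |-> area * dot w (X f). *)
Definition face_field (f : 'I_4) (y : pt R) : pt R :=
  - (area * dot (X f) (X f))^-1 *: cross (X f) y.
Definition edge_field (e : edge) (z : R) : pt R := (z / dot (E e) (E e)) *: E e.
Definition face_flux (f : 'I_4) (o : R) : pt R :=
  (o / (area * dot (X f) (X f))) *: X f.

Lemma area_dot_neq0 f : area * dot (X f) (X f) != 0.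
Proof.
by rewrite mulf_neq0 ?gt_eqF ?area_gt0 // dotvv_gt0 // face_vec_neq0.
Qed.

(** On the plane orthogonal to [X f], taking the cross product with [X f] twice is multiplication by
    [- dot (X f) (X f)], so this map is invertible there. *)
Lemma face_fieldK f y : dot (X f) y = 0 ->
  area *: cross (X f) (face_field f y) = y.
Proof.
move=> Xy; rewrite /face_field crossZr cross_cross Xy scale0r sub0r scaleNr.
rewrite !scalerN opprK !scalerA -[RHS]scale1r; congr (_ *: _).
have A0 : area != 0 :> R by rewrite gt_eqF ?area_gt0.
have X0 : dot (X f) (X f) != 0 by rewrite gt_eqF // dotvv_gt0 // face_vec_neq0.
by field; rewrite A0 X0.
Qed.

Lemma cross_face_fieldK f u : dot (X f) u = 0 ->
  face_field f (area *: cross (X f) u) = u.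
Proof.
move=> Xu; rewrite /face_field crossZr cross_cross Xu scale0r sub0r scaleNr.
rewrite !scalerN opprK !scalerA -[RHS]scale1r; congr (_ *: _).
have A0 : area != 0 :> R by rewrite gt_eqF ?area_gt0.
have X0 : dot (X f) (X f) != 0 by rewrite gt_eqF // dotvv_gt0 // face_vec_neq0.
by field; rewrite A0 X0.
Qed.

Lemma dot_face_field f y : dot (X f) (face_field f y) = 0.
Proof. by rewrite /face_field dotZr dot_crossl mulr0. Qed.

Lemma edge_fieldK e z : dot (edge_field e z) (E e) = z.
Proof. by rewrite /edge_field dotZl divfK // gt_eqF // dotvv_gt0 //
  edge_vec_neq0. Qed.

Lemma face_fluxK f o : area * dot (face_flux f o) (X f) = o.
Proof.
have A0 : area != 0 :> R by rewrite gt_eqF ?area_gt0.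
have X0 : dot (X f) (X f) != 0 by rewrite gt_eqF // dotvv_gt0 // face_vec_neq0.
by rewrite /face_flux dotZl; field; rewrite A0 X0.
Qed.

Definition coch1 (a0 : R) (af : 'I_4 -> R) (ae : edge -> R) (an : 'I_4 -> R) :
    C1 R :=
  (cst_on (tetra p) a0, fun f => cst_on (face p f) (af f),
   fun e => cst_on (segment p e) (ae e), an).

(** Faithful only when [y f] is orthogonal to [X f], since [face_field] kills the normal component;
    hence the orthogonality conditions in [V2P] and [coch2_inj]. *)
Definition coch2 (u0 : pt R) (y : 'I_4 -> pt R) (z : edge -> R) : C2 R :=
  (cst_on (tetra p) u0, fun f => cst_on (face p f) (face_field f (y f)),
   fun e => cst_on (segment p e) (edge_field e (z e))).

Definition coch3 (w0 : pt R) (o : 'I_4 -> R) : C3 R :=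
  (cst_on (tetra p) w0, fun f => cst_on (face p f) (face_flux f (o f))).

Definition coch4 (d : R) : C4 R := cst_on (tetra p) d.

Lemma IwE a1 a2 a3 a4 :
  Iw p (a1, a2, a3, a4) = coch1 a1 (fun=> a2) (fun=> a3) (fun=> a4).
Proof. by []. Qed.

Lemma V1P v : V1 0 p v <-> exists a0 af ae an, v = coch1 a0 af ae an.
Proof.
split; last first.
  by case=> a0 [af [ae [an ->]]]; split=> [|f|e]; apply/Pk0P; eexists.
case: v => [[[v vf] ve] an] [/Pk0P [a0 ->] hf he].
have [af haf] := choice (fun f => (Pk0P _ _).1 (hf f)).
have [ae hae] := choice (fun e => (Pk0P _ _).1 (he e)).
by exists a0, af, ae, an; congr (_, _, _, _); exact/funext.
Qed.

Lemma V2P u : V2 0 p F u <->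
  exists u0 y z, (forall f, dot (X f) (y f) = 0) /\ u = coch2 u0 y z.
Proof.
have [nF [tF eF]] := hF.
split; last first.
  case=> u0 [y [z [Xy ->]]]; split => [|f|e].
  - by apply/Pk3_0P; eexists.
  - apply/Pk_tan0P; set w := face_field _ _.
    exists (dot (tf1 F f) w), (dot (tf2 F f) w).
    have [n1 _] := nF f; have [h1 h2 h12 h1n h2n] := tF f.
    rewrite -(orthonormal_frame h1 h2 n1) //.
    by apply/eqP; rewrite (dot_nf_eq0 ndp hF) dot_face_field.
  - apply/Pk_dir0P; have [s s1 h] := teE ndp hF e.
    (* [E e] is [s * enorm (E e)] times [te F e], because [s ^+ 2 = 1]. *)
    exists (z e / dot (E e) (E e) * (s * enorm (E e))).
    congr cst_on; rewrite -[RHS]scalerA -[(s * _) *: _]scalerA h [s *: (s *: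
      _)]scalerA -expr2.
    by rewrite s1 scale1r.
case: u => [[u0 uf] ue] [/Pk3_0P [a0 ->] hf he].
have [|af haf] := @choice _ _
  (fun f a => uf f = cst_on (face p f) a /\ dot (X f) a = 0).
  move=> f; have /Pk_tan0P [a [b ->]] := hf f.
  exists (a *: tf1 F f + b *: tf2 F f); split => //; apply/eqP.
  have [h1 h2 h12 h1n h2n] := tF f.
  by rewrite -(dot_nf_eq0 ndp hF) dotC dotDl !dotZl h1n h2n !mulr0 addr0.
have [|ae hae] := @choice _ _
  (fun e a => ue e = cst_on (segment p e) (edge_field e a)).
  move=> e; have /Pk_dir0P [c ->] := he e.
  have [_ [r ->]] := eF e; rewrite -/(E e) scalerA.
  exists (c * r * dot (E e) (E e)); congr cst_on; rewrite /edge_field mulfK //.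
  by rewrite gt_eqF // dotvv_gt0 // edge_vec_neq0.
exists a0, (fun f => area *: cross (X f) (af f)), ae; split.
  by move=> f; rewrite dotZr dot_crossl mulr0.
congr (_, _, _); apply/funext => i //.
by have [-> Xa] := haf i; rewrite cross_face_fieldK.
Qed.

Lemma V3P w : V3 0 p F w <-> exists w0 o, w = coch3 w0 o.
Proof.
split; last first.
  case=> w0 [om ->]; split; first by apply/Pk3_0P; exists w0.
  move=> f; apply/Pk_dir0P; have [s s1 h] := nfE ndp hF f.
  exists (om f / (area * dot (X f) (X f)) * (s * enorm (X f))).
  congr cst_on; rewrite -[RHS]scalerA -[(s * _) *: _]scalerA h [s *: (s *:
    _)]scalerA -expr2.
  by rewrite s1 scale1r.
case: w => [w0 wf] [/Pk3_0P [a0 ->] hf].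
have [|af haf] := @choice _ _
  (fun f a => wf f = cst_on (face p f) (face_flux f a)).
  move=> f; have /Pk_dir0P [c ->] := hf f.
  have [s s1 h] := nfE ndp hF f; have X0 := enorm_gt0 (face_vec_neq0 ndp f).
  have -> : nf F f = (s / enorm (X f)) *: X f.
    apply: (scalerI (lt0r_neq0 X0)); rewrite h scalerA; congr (_ *: _).
    by rewrite mulrC divfK // gt_eqF.
  rewrite scalerA; exists (c * (s / enorm (X f)) * (area * dot (X f) (X f))).
  by congr cst_on; rewrite /face_flux mulfK // area_dot_neq0.
by exists a0, af; congr (_, _); exact/funext.
Qed.

Lemma V4P d : V4 0 p d <-> exists c, d = coch4 c.
Proof. exact: Pk0P. Qed.

Lemma coch2_inj u0 y z u0' y' z' :
  (forall f, dot (X f) (y f) = 0) -> (forall f, dot (X f) (y' f) = 0) ->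
  coch2 u0 y z = coch2 u0' y' z' -> [/\ u0 = u0', y =1 y' & z =1 z'].
Proof.
move=> Xy Xy' [h0 hf he]; split; first exact: cst_on_inj (tetra_neq0 p) h0.
- move=> f; have := cst_on_inj (face_neq0 p f) (congr1 (@^~ f) hf).
  by move/(congr1 (fun u => area *: cross (X f) u)); rewrite !face_fieldK.
- move=> e; have := cst_on_inj (segment_neq0 p e) (congr1 (@^~ e) he).
  by move/(congr1 (fun u => dot u (E e))); rewrite !edge_fieldK.
Qed.

Lemma coch3_inj w0 o w0' o' :
  coch3 w0 o = coch3 w0' o' -> w0 = w0' /\ o =1 o'.
Proof.
case=> h0 hf; split; first exact: cst_on_inj (tetra_neq0 p) h0.
move=> f; have := cst_on_inj (face_neq0 p f) (congr1 (@^~ f) hf).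
by move/(congr1 (fun u => area * dot u (X f))); rewrite !face_fluxK.
Qed.

Lemma coch4_inj d d' : coch4 d = coch4 d' -> d = d'.
Proof. exact: cst_on_inj (tetra_neq0 p). Qed.

Lemma coch2_0 : coch2 0 (fun=> 0) (fun=> 0) = 0.
Proof.
congr (_, _, _); rewrite ?cst_on0 //; apply/funext => i.
  by rewrite /face_field cross0r scaler0 cst_on0.
by rewrite /edge_field mul0r scale0r cst_on0.
Qed.

Lemma coch3_0 : coch3 0 (fun=> 0) = 0.
Proof.
congr (_, _); rewrite ?cst_on0 //; apply/funext => i.
by rewrite /face_flux mul0r scale0r cst_on0.
Qed.

Lemma coch4_0 : coch4 0 = 0.
Proof. exact: cst_on0. Qed.

End Coordinates.

(** * The weak operators on constants *)

Section Operators.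
Context {R : realType}.
Variables (p : 'I_4 -> pt R) (F : frame R).
Hypotheses (ndp : nondegenerate_tetra p) (hF : is_frame p F).

Notation X := (face_vec p).
Notation E := (edge_vec p).
Notation sgD := (Num.sg (det3 p)).

Lemma dot_sumr (I : Type) (r : seq I) (P : pred I) (G : I -> pt R) u :
  dot u (\sum_(i <- r | P i) G i) = \sum_(i <- r | P i) dot u (G i).
Proof.
by elim/big_rec2: _ => [|i x y _ <-]; rewrite ?dot0r // dotDr.
Qed.

Lemma dot_alt u (y : 'I_4 -> pt R) : dot u (alt y) = alt (fun f => dot u (y f)).
Proof. by rewrite /alt !dotDr !dotNr. Qed.

Lemma dot_bdry u (z : edge -> pt R) f :
  dot u (bdry z f) = bdry (fun e => dot u (z e)) f.
Proof. by rewrite -!(sum_edge_in (R := R)) dot_sumr; apply: eq_bigr => e _;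
  rewrite dotZr. Qed.

Lemma int_tetra_dot u0 theta :
  int_tetra p (fun x => dot (cst_on (tetra p) u0 x) theta) = vol p * dot u0
    theta.
Proof. by apply: int_tetra_cst => // x Tx; rewrite cst_onE. Qed.

Lemma int_tetra0 (g : pt R -> R) : (forall x, g x = 0) -> int_tetra p g = 0.
Proof. by move=> g0; rewrite (int_tetra_cst (c := 0)) ?mulr0. Qed.

Lemma int_face0 f (g : pt R -> R) : (forall x, g x = 0) -> int_face p f g = 0.
Proof. by move=> g0; rewrite (int_face_cst (c := 0)) ?mulr0. Qed.

Lemma int_edge0 e (g : pt R -> R) : (forall x, g x = 0) -> int_edge p e g = 0.
Proof. by move=> g0; rewrite (int_edge_cst (c := 0)) ?mulr0. Qed.

Lemma bdry_face_vec0 (a : edge -> R) f :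
  dot (X f) (bdry (fun e => a e *: E e) f) = 0.
Proof.
rewrite -(sum_edge_in (R := R)) dot_sumr big1 // => e fe.
by rewrite !dotZr dot_face_edge // !mulr0.
Qed.

(** The difference [u - v] is itself in the span of [tf1 F f] and [tf2 F f], so it can be tested
    against itself. *)
Lemma tangent_ext f u v : dot (X f) u = 0 -> dot (X f) v = 0 ->
  (forall a b, dot (a *: tf1 F f + b *: tf2 F f) u =
               dot (a *: tf1 F f + b *: tf2 F f) v) -> u = v.
Proof.
move=> Xu Xv h; have [nF [tF _]] := hF.
have [n1 _] := nF f; have [h1 h2 h12 h1n h2n] := tF f.
apply/eqP; rewrite -subr_eq0; apply/eqP/dotvv_eq0.
have X0 : dot (nf F f) (u - v) = 0.
  by apply/eqP; rewrite (dot_nf_eq0 ndp hF) dotBr Xu Xv subrr.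
set w := u - v in X0 *; rewrite {1}(orthonormal_frame h1 h2 n1 h12 h1n h2n X0).
by rewrite {3}/w dotBr h subrr.
Qed.

(** The factor [enorm (X f)] of the surface integral combines with the unit normal into a signed
    [X f], which leaves neither a square root nor the frame. *)
Lemma int_bdry_tetra_cst (u : 'I_4 -> pt R) (g : 'I_4 -> pt R -> R) :
  (forall f x, face p f x -> g f x = dot (u f) (outward p F f)) ->
  int_bdry_tetra p g = - (area * sgD * alt (fun f => dot (u f) (X f))).
Proof.
move=> h; rewrite -(sum_eps (R := R)) mulr_sumr -sumrN; apply: eq_bigr => f _.
rewrite (int_face_cst (h f)) -mulrA -dotZr (scale_outward ndp hF) dotZr /=.
by rewrite /GRing.scale /=; ring.
Qed.

Lemma int_bdry_face_cst f (s : R) (u : edge -> pt R) (g : edge -> pt R -> R) :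
  s ^+ 2 = 1 -> enorm (X f) *: nf F f = s *: X f ->
  (forall e x, segment p e x -> g e x = dot (u e) (bdry_tangent p F f e)) ->
  int_bdry_face p f g = s * bdry (fun e => dot (u e) (E e)) f.
Proof.
move=> s1 hs h; rewrite -(sum_edge_in (R := R)) mulr_sumr;
  apply: eq_bigr => e fe.
rewrite (int_edge_cst (h e)) -dotZr (scale_bdry_tangent ndp hF s1 hs fe) dotZr.
by rewrite /GRing.scale /= mulrA.
Qed.

(** [eq1], [eq2] and [eq3] evaluate the identities at one constant test function. Letting it range
    over all vectors, over the tangent vectors of a face and over scalars turns them into equations
    between components. *)
Lemma is_wgradP a0 af ae an u0 y z : (forall f, dot (X f) (y f) = 0) ->
  is_wgrad 0 p F (coch1 p a0 af ae an) (coch2 p u0 y z) <->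
  [/\ u0 = - (area * sgD / vol p) *: alt (fun f => af f *: X f),
      y =1 bdry (fun e => ae e *: E e)
    & forall e, z e = an (tgt e) - an (src e)].
Proof.
move=> Xy; have T0 := vol_gt0 ndp.
have eq1 phi : int_tetra p (fun x => dot (cst_on (tetra p) u0 x) phi) =
    - int_tetra p (fun x => cst_on (tetra p) a0 x * div (fun=> phi) x) +
    int_bdry_tetra p (fun f x =>
      cst_on (face p f) (af f) x * dot phi (outward p F f)) <->
  dot u0 phi = dot (- (area * sgD / vol p) *: alt (fun f => af f *: X f)) phi.
  rewrite int_tetra_dot int_tetra0; last by move=> x; rewrite div_cst mulr0.
  rewrite (@int_bdry_tetra_cst (fun f => af f *: phi)); last first.
    by move=> f x fx; rewrite cst_onE // dotZl.
  rewrite oppr0 add0r.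
  have -> : alt (fun f => dot (af f *: phi) (X f)) =
      dot (alt (fun f => af f *: X f)) phi.
    rewrite dotC dot_alt; congr alt; apply/funext => f.
    by rewrite dotZl dotZr.
  rewrite dotZl; set A := dot _ _; set B := dot (alt _) _.
  have -> : - (area * sgD * B) = vol p * (- (area * sgD / vol p) * B).
    by field; rewrite gt_eqF.
  by split=> [/(mulfI (lt0r_neq0 T0))|->].
have eq2 f a b : let th := a *: tf1 F f + b *: tf2 F f in
  int_face p f (fun x => dot (cst_on (face p f) (face_field p f (y f)) x)
     (cross th (nf F f))) =
    - int_face p f (fun x => cst_on (face p f) (af f) x *
        dot (curl (fun=> th) x) (nf F f)) +
    int_bdry_face p f (fun e x =>
      cst_on (segment p e) (ae e) x * dot th (bdry_tangent p F f e)) <->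
  dot th (y f) = dot th (bdry (fun e => ae e *: E e) f).
  move=> th; have [s s1 hs] := nfE ndp hF f.
  have s0 := sqr1_neq0 s1.
  rewrite (@int_face_cst _ _ _ _ (dot (face_field p f (y f)) (cross th (nf F
    f)))).
    2: by move=> x fx; rewrite cst_onE.
  rewrite -mulrA -dotZr -crossZr hs crossZr dotZr.
  rewrite int_face0; last by move=> x; rewrite curl_cst dot0l mulr0.
  rewrite (@int_bdry_face_cst f s (fun e => ae e *: th)) //; last first.
    by move=> e x ex; rewrite cst_onE // dotZl.
  rewrite oppr0 add0r dot_bdry.
  (* Cyclic invariance of the triple product moves the cross product with [X f] from the test vector
     to the field, which produces the coordinate [y f]. *)
  have -> : dot (face_field p f (y f)) (cross th (X f)) =
    dot th (cross (X f) (face_field p f (y f))) by exact: dot_cross_rot.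
  have -> : area * (s * dot th (cross (X f) (face_field p f (y f)))) =
      s * dot th (y f).
    by rewrite -{2}(face_fieldK ndp (Xy f)) dotZr; ring.
  have -> : (fun e => dot (ae e *: th) (E e)) = (fun e => dot th (ae e *: E e)).
    by apply/funext => e; rewrite dotZl dotZr.
  by split=> [/(mulfI s0)|->].
have eq3 e c : int_edge p e (fun x =>
      dot (cst_on (segment p e) (edge_field p e (z e)) x) (c *: te F e)) =
    - int_edge p e (fun x => cst_on (segment p e) (ae e) x *
        dot (grad (fun=> c) x) (te F e)) +
    (an (tgt e) * (c * dot (te F e) (edge_outward p e)) +
     an (src e) * (c * dot (te F e) (- edge_outward p e))) <->
    c * z e = c * (an (tgt e) - an (src e)).
  have [s s1 hs] := teE ndp hF e; have L0 := enorm_gt0 (edge_vec_neq0 ndp e).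
  have s0 := sqr1_neq0 s1.
  rewrite (@int_edge_cst _ _ _ _ (dot (edge_field p e (z e)) (c *: te F e))).
    2: by move=> x ex; rewrite cst_onE.
  rewrite int_edge0; last by move=> x; rewrite grad_cst dot0l mulr0.
  rewrite dotZr mulrCA -(dotZr (enorm (E e))) hs dotZr edge_fieldK //.
  have tE : dot (te F e) (edge_outward p e) = s.
    rewrite /edge_outward -/(E e) dotZr -[te F e]scale1r -(mulVf (lt0r_neq0
      L0)).
    rewrite -scalerA hs !dotZl -enorm_sqr.
    by field; rewrite gt_eqF.
  rewrite dotNr tE.
  have -> : - 0 + (an (tgt e) * (c * s) + an (src e) * (c * - s)) =
     s * (c * (an (tgt e) - an (src e))) by ring.
  by rewrite mulrCA; split=> [/(mulfI s0)|->].
split=> [[_ h1 h2 h3]|[h1 h2 h3]]; split.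
- apply: dot_ext => phi; apply/eq1; apply: (h1 (fun=> phi)).
  by apply/Pk3_0P; exists phi; rewrite cst_onT.
- move=> f; apply: (tangent_ext (f := f)) => // [|a b];
    first exact: bdry_face_vec0.
  apply/eq2; apply: (h2 f (fun=> _)); apply/Pk_tan0P.
  by exists a, b; rewrite cst_onT.
- move=> e; apply: (mulfI (oner_neq0 R)); apply/eq3; apply: (h3 e (fun=> 1)).
  by apply/Pk0P; exists 1; rewrite cst_onT.
- by apply/V2P => //; exists u0, y, z.
- by move=> _ /Pk3_0P [phi ->]; rewrite cst_onT; apply/eq1; rewrite h1.
- move=> f _ /Pk_tan0P [a [b ->]]; rewrite cst_onT; apply/eq2.
  by rewrite h2.
- by move=> e _ /Pk0P [c ->]; rewrite cst_onT; apply/eq3; rewrite h3.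
Qed.

(** In the volume identity each face term is a triple product of the field, the test vector and
    [X f], that is, the pairing of [y f] with the test vector up to the area. In the face identity
    both sides carry the sign of the normal, which cancels. *)
Lemma is_wcurlP u0 y z w0 om : (forall f, dot (X f) (y f) = 0) ->
  is_wcurl 0 p F (coch2 p u0 y z) (coch3 p w0 om) <->
  w0 = - (sgD / vol p) *: alt y /\ om =1 bdry z.
Proof.
move=> Xy; have T0 := vol_gt0 ndp.
have eq1 th : int_tetra p (fun x => dot (cst_on (tetra p) w0 x) th) =
    int_tetra p (fun x => dot (cst_on (tetra p) u0 x) (curl (fun=> th) x)) +
    int_bdry_tetra p (fun f x =>
      dot (cst_on (face p f) (face_field p f (y f)) x) (cross th (outward p F
        f)))
  <-> dot w0 th = dot (- (sgD / vol p) *: alt y) th.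
  rewrite int_tetra_dot int_tetra0; last by move=> x; rewrite curl_cst dot0r.
  rewrite (@int_bdry_tetra_cst (fun f => cross (face_field p f (y f)) th));
    last first.
    by move=> f x fx; rewrite cst_onE // dot_crossC.
  rewrite add0r dotZl -mulrA.
  have -> : sgD * alt (fun f => dot (cross (face_field p f (y f)) th) (X f)) =
     sgD * (area^-1 * dot (alt y) th).
    have A0 : area != 0 :> R by rewrite gt_eqF ?area_gt0.
    congr (_ * _); apply: (mulfI A0); rewrite mulrA divff // mul1r dotC dot_alt.
    rewrite -(sum_eps (R := R)) mulr_sumr -(sum_eps (R := R));
      apply: eq_bigr => f _.
    rewrite dot_crossC dot_cross_rot -{2}(face_fieldK ndp (Xy f)) dotZr.
    exact: mulrCA.
  set A := dot w0 _; set B := dot (alt _) _.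
  have -> : - (area * (sgD * (area^-1 * B))) = vol p * (- (sgD / vol p) * B).
    by field; rewrite !gt_eqF ?area_gt0.
  by split=> [/(mulfI (lt0r_neq0 T0))|->].
have eq2 f c : int_face p f (fun x =>
      dot (cst_on (face p f) (face_flux p f (om f)) x) (c *: nf F f)) =
    int_face p f (fun x => dot (cst_on (face p f) (face_field p f (y f)) x)
        (cross (grad (fun=> c) x) (nf F f))) +
    int_bdry_face p f (fun e x =>
      dot (cst_on (segment p e) (edge_field p e (z e)) x)
        (c *: bdry_tangent p F f e)) <->
    c * om f = c * bdry z f.
  have [s s1 hs] := nfE ndp hF f.
  have s0 := sqr1_neq0 s1.
  rewrite (@int_face_cst _ _ _ _ (dot (face_flux p f (om f)) (c *: nf F f))).
    2: by move=> x fx; rewrite cst_onE.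
  rewrite int_face0; last by move=> x; rewrite grad_cst cross0l dot0r.
  rewrite (@int_bdry_face_cst f s (fun e => c *: edge_field p e (z e))) //;
    last first.
    by move=> e x ex; rewrite cst_onE // dotZl dotZr.
  rewrite add0r dotZr -mulrA (mulrCA (enorm _) c) -(dotZr (enorm (X f))) hs
    dotZr.
  have -> : area * (c * (s * dot (face_flux p f (om f)) (X f))) = s * (c * om
    f).
    by rewrite -{2}(face_fluxK ndp f (om f)); ring.
  have -> : bdry (fun e => dot (c *: edge_field p e (z e)) (E e)) f = c * bdry
    z f.
    have -> : (fun e => dot (c *: edge_field p e (z e)) (E e)) = (fun e => c *
      z e).
      by apply/funext => e; rewrite dotZl edge_fieldK.
    by rewrite /bdry; case: (val f) => [|[|[|?]]]; ring.
  by split=> [/(mulfI s0)|->].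
split=> [[_ h1 h2]|[h1 h2]]; split.
- apply: dot_ext => th; apply/eq1; apply: (h1 (fun=> th)).
  by apply/Pk3_0P; exists th; rewrite cst_onT.
- move=> f; apply: (mulfI (oner_neq0 R)); apply/eq2; apply: (h2 f (fun=> 1)).
  by apply/Pk0P; exists 1; rewrite cst_onT.
- by apply/V3P => //; exists w0, om.
- by move=> _ /Pk3_0P [phi ->]; rewrite cst_onT; apply/eq1; rewrite h1.
- by move=> f _ /Pk0P [c ->]; rewrite cst_onT; apply/eq2; rewrite h2.
Qed.

Lemma is_wdivP w0 om d :
  is_wdiv 0 p F (coch3 p w0 om) (coch4 p d) <-> d = - (sgD / vol p) * alt om.
Proof.
have T0 := vol_gt0 ndp.
have eq1 c : int_tetra p (fun x => cst_on (tetra p) d x * c) =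
    - int_tetra p (fun x => dot (cst_on (tetra p) w0 x) (grad (fun=> c) x)) +
    int_bdry_tetra p (fun f x =>
      dot (cst_on (face p f) (face_flux p f (om f)) x) (c *: outward p F f))
  <-> c * d = c * (- (sgD / vol p) * alt om).
  rewrite (int_tetra_cst (c := d * c)) //; last by move=> x Tx; rewrite cst_onE.
  rewrite int_tetra0; last by move=> x; rewrite grad_cst dot0r.
  rewrite (@int_bdry_tetra_cst (fun f => c *: face_flux p f (om f)));
    last first.
    by move=> f x fx; rewrite cst_onE // dotZl dotZr.
  have A0 : area != 0 :> R by rewrite gt_eqF ?area_gt0.
  have -> : (fun f => dot (c *: face_flux p f (om f)) (X f)) =
            (fun f => area^-1 * (c * om f)).
    apply/funext => f; rewrite dotZl -{2}(face_fluxK ndp f (om f)).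
    by apply: (mulfI A0); rewrite [RHS]mulrA divff // mul1r; ring.
  rewrite oppr0 add0r.
  have -> : - (area * sgD * alt (fun f => area^-1 * (c * om f))) =
      vol p * (c * (- (sgD / vol p) * alt om)).
    by rewrite /alt; field; rewrite A0 gt_eqF.
  by rewrite (mulrC d); split=> [/(mulfI (lt0r_neq0 T0))|->].
split=> [[_ h1]|h1].
- apply: (mulfI (oner_neq0 R)); apply/eq1; apply: (h1 (fun=> 1)).
  by apply/Pk0P; exists 1; rewrite cst_onT.
split; first by apply/V4P; exists d.
by move=> _ /Pk0P [c ->]; rewrite cst_onT; apply/eq1; rewrite h1.
Qed.

End Operators.

(** * Exactness of the finite complex *)

Section DiscreteExactness.
Context {R : realType}.
Variable p : 'I_4 -> pt R.
Hypothesis ndp : nondegenerate_tetra p.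

Notation X := (face_vec p).
Notation E := (edge_vec p).

(** Crossing the relation with [c] and with [b] isolates each coefficient. *)
Lemma cross_indep (b c : pt R) (s t : R) : cross b c != 0 ->
  s *: b + t *: c = 0 -> s = 0 /\ t = 0.
Proof.
move=> bc0 h; have hs : s *: cross b c = cross (s *: b + t *: c) c by vring.
have ht : t *: cross b c = cross b (s *: b + t *: c) by vring.
rewrite h cross0l in hs; rewrite h cross0r in ht.
move/eqP: hs; move/eqP: ht.
by rewrite !scaler_eq0 (negbTE bc0) !orbF => /eqP -> /eqP ->.
Qed.

Lemma plane_decomp (b c y : pt R) : cross b c != 0 -> dot (cross b c) y = 0 ->
  exists s t, y = s *: b + t *: c.
Proof.
move=> X0 Xy; have XX0 := dotvv_gt0 X0; set x := cross b c in XX0.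
exists (dot (cross y c) x / dot x x), (dot (cross b y) x / dot x x).
apply: (scalerI (lt0r_neq0 XX0)).
(* Expansion of [y] in the basis [b], [c], [x], multiplied by [dot x x]; the component along [x]
   vanishes by [Xy]. *)
transitivity (dot (cross y c) x *: b + dot (cross b y) x *: c + dot x y *: x).
  by rewrite /x; vring.
rewrite Xy scale0r addr0 scalerDr !scalerA.
by congr (_ *: _ + _ *: _); rewrite mulrC divfK // gt_eqF.
Qed.

Lemma dual_ext (u w : pt R) :
  (forall i, dot u (p i - p v0) = dot w (p i - p v0)) -> u = w.
Proof.
move=> h; apply: (scalerI (det3_neq0 ndp)); rewrite /det3.
have key (a b c x : pt R) : dot a (cross b c) *: x =
    dot x a *: cross b c + dot x b *: cross c a + dot x c *: cross a b by vring.
by rewrite !key !h.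
Qed.

Lemma basis_decomp (w : pt R) : exists s1 s2 s3 : R,
  w = s1 *: (p v1 - p v0) + s2 *: (p v2 - p v0) + s3 *: (p v3 - p v0).
Proof.
have := det3_neq0 ndp; rewrite /det3.
move: (p v1 - p v0) (p v2 - p v0) (p v3 - p v0) => a b c D0.
exists (dot w (cross b c) / dot a (cross b c)),
  (dot w (cross c a) / dot a (cross b c)), (dot w (cross a b) / dot a (cross b
    c)).
apply: (scalerI D0).
have -> : dot a (cross b c) *: w = dot w (cross b c) *: a +
    dot w (cross c a) *: b + dot w (cross a b) *: c by vring.
rewrite !scalerDr !scalerA.
by congr (_ *: _ + _ *: _ + _ *: _); rewrite mulrC divfK.
Qed.

Lemma basis_indep (s1 s2 s3 : R) :
  s1 *: (p v1 - p v0) + s2 *: (p v2 - p v0) + s3 *: (p v3 - p v0) = 0 ->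
  [/\ s1 = 0, s2 = 0 & s3 = 0].
Proof.
have := det3_neq0 ndp; rewrite /det3.
move: (p v1 - p v0) (p v2 - p v0) (p v3 - p v0) => a b c D0 h.
have h1 : s1 * dot a (cross b c) = dot (s1 *: a + s2 *: b + s3 *: c) (cross b
  c) by vring.
have h2 : s2 * dot a (cross b c) = dot (s1 *: a + s2 *: b + s3 *: c) (cross c
  a) by vring.
have h3 : s3 * dot a (cross b c) = dot (s1 *: a + s2 *: b + s3 *: c) (cross a
  b) by vring.
rewrite h !dot0l in h1 h2 h3.
by split; apply: (mulIf D0); rewrite mul0r.
Qed.

(** For [i] other than [v0], the edge from [p v0] to [p i] lies in every face except the two
    opposite to its end points. Only these two terms survive, and each contributes the determinant
    up to sign. *)
Lemma dot_alt_face_vec (a : 'I_4 -> R) i :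
  dot (alt (fun f => a f *: X f)) (p i - p v0) = det3 p * (a i - a v0).
Proof.
rewrite /alt /face_vec !lift_v /det3; elim/ord4_ind: i;
  move: (p v0) (p v1) (p v2) (p v3) (a v0) (a v1) (a v2) (a v3); clear; vring.
Qed.

Lemma alt_face_vec_eq0 (a : 'I_4 -> R) :
  alt (fun f => a f *: X f) = 0 <-> forall f, a f = a v0.
Proof.
split=> [h f|h].
  have := dot_alt_face_vec a f; rewrite h dot0l => /esym/eqP.
  by rewrite mulf_eq0 (negbTE (det3_neq0 ndp)) subr_eq0 => /eqP.
by apply: dual_ext => i; rewrite dot_alt_face_vec h subrr mulr0 dot0l.
Qed.

Lemma alt_face_vec_surj (u : pt R) : exists a, alt (fun f => a f *: X f) = u.
Proof.
(* The values are read off from [dot_alt_face_vec], with value 0 at [v0]. *)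
exists (fun f => dot u (p f - p v0) / det3 p); apply: dual_ext => i.
rewrite dot_alt_face_vec subrr dot0r mul0r subr0 mulrC divfK //.
exact: det3_neq0.
Qed.

(** The signed edge vectors around a face add up to zero, so one of the three is eliminated and only
    differences of values of [a] remain. *)
Lemma bdry_edge_vec (a : edge -> R) :
  [/\ bdry (fun e => a e *: E e) v0 =
        (a e12 - a e23) *: (p v2 - p v1) + (a e23 - a e13) *: (p v3 - p v1),
      bdry (fun e => a e *: E e) v1 =
        (a e02 - a e23) *: (p v2 - p v0) + (a e23 - a e03) *: (p v3 - p v0),
      bdry (fun e => a e *: E e) v2 =
        (a e01 - a e13) *: (p v1 - p v0) + (a e13 - a e03) *: (p v3 - p v0)
    & bdry (fun e => a e *: E e) v3 =
        (a e01 - a e12) *: (p v1 - p v0) + (a e12 - a e02) *: (p v2 - p v0)].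
Proof.
rewrite /bdry /edge_vec !src_tgt /=.
move: (p v0) (p v1) (p v2) (p v3) (a e01) (a e02) (a e03) (a e12) (a e13) (a
  e23).
by clear=> *; split; vring.
Qed.

(** Independence of two edges of a face forces equal values on its three edges; the faces at [p v0]
    share edges, so the value is common to all six. *)
Lemma bdry_edge_vec_eq0 (a : edge -> R) :
  (forall f, bdry (fun e => a e *: E e) f = 0) <-> forall e, a e = a e01.
Proof.
have [h0 h1 h2 h3] := bdry_edge_vec a.
split=> [h|h]; last first.
  by apply: ord4_ind; rewrite ?h0 ?h1 ?h2 ?h3 !h !subrr !scale0r addr0.
have Xn f := face_vec_neq0 ndp f.
have [] : a e02 - a e23 = 0 /\ a e23 - a e03 = 0.
  by apply: cross_indep (etrans (esym h1) (h v1)); have := Xn v1;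
    rewrite /face_vec !lift_v.
have [] : a e01 - a e13 = 0 /\ a e13 - a e03 = 0.
  by apply: cross_indep (etrans (esym h2) (h v2)); have := Xn v2;
    rewrite /face_vec !lift_v.
have [] : a e01 - a e12 = 0 /\ a e12 - a e02 = 0.
  by apply: cross_indep (etrans (esym h3) (h v3)); have := Xn v3;
    rewrite /face_vec !lift_v.
by move=> ? ? ? ? ? ?; apply: edge_ind; lra.
Qed.

Lemma alt_bdry (z : edge -> R) : alt (bdry z) = 0.
Proof. by rewrite /alt /bdry /=; ring. Qed.

Lemma alt_bdry_vec (z : edge -> pt R) : alt (bdry z) = 0.
Proof. by rewrite /alt /bdry /=; vring. Qed.

(** The tangential vectors [y f] have eight coordinates, on which [alt y = 0] imposes three
    relations. The five left match six edge values up to a common constant. *)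
Lemma bdry_edge_vec_surj (y : 'I_4 -> pt R) : (forall f, dot (X f) (y f) = 0) ->
  alt y = 0 -> exists a, y =1 bdry (fun e => a e *: E e).
Proof.
move=> Xy y0; have Xn f := face_vec_neq0 ndp f.
have [s0 [t0 h0]] := plane_decomp (Xn v0) (Xy v0).
have [s1 [t1 h1]] := plane_decomp (Xn v1) (Xy v1).
have [s2 [t2 h2]] := plane_decomp (Xn v2) (Xy v2).
have [s3 [t3 h3]] := plane_decomp (Xn v3) (Xy v3).
rewrite !lift_v in h0 h1 h2 h3.
have [] : [/\ s0 + t0 - s2 + s3 = 0, - s0 + s1 + t3 = 0 & - t0 + t1 - t2 = 0].
  apply: basis_indep; rewrite -{}[RHS]y0 /alt h0 h1 h2 h3.
  by move: (p v0) (p v1) (p v2) (p v3); clear; vring.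
move=> r1 r2 r3.
(* The common constant is fixed by the value 0 on [e01]. The faces [v3] and [v2] then determine
   [e12], [e02], [e13], [e03], and the face [v1] determines [e23]; the other equations follow from
   [r1], [r2], [r3]. *)
pose a e := if e == e12 then - s3 else if e == e13 then - s2 else
  if e == e02 then - s3 - t3 else if e == e03 then - s2 - t2 else
  if e == e23 then - s3 - t3 - s1 else 0.
exists a; have [k0 k1 k2 k3] := bdry_edge_vec a.
apply: ord4_ind; rewrite ?k0 ?k1 ?k2 ?k3 ?h0 ?h1 ?h2 ?h3 /a /=;
  congr (_ *: _ + _ *: _); lra.
Qed.

Lemma alt_tangent_surj (w : pt R) :
  exists2 y, forall f, dot (X f) (y f) = 0 & alt y = w.
Proof.
have [s1 [s2 [s3 ->]]] := basis_decomp w.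
(* The first two edge vectors at [p v0] are tangent to the face [v3], the third one to the face
   [v2], where [alt] has a minus sign; hence [- s3]. *)
exists (fun f => if f == v3 then s1 *: (p v1 - p v0) + s2 *: (p v2 - p v0) else
  if f == v2 then (- s3) *: (p v3 - p v0) else 0).
  apply: ord4_ind; rewrite /face_vec /= ?dot0r // !lift_v.
    by move: (p v0) (p v1) (p v2) (p v3); clear; vring.
  by move: (p v0) (p v1) (p v2) (p v3); clear; vring.
by rewrite /alt /= oppr0 !add0r scaleNr opprK addrC.
Qed.

Lemma bdry_diff0 (a : 'I_4 -> R) f : bdry (fun e => a (tgt e) - a (src e)) f =
  0.
Proof. by rewrite /bdry !src_tgt; case: (val f) => [|[|[|?]]]; ring. Qed.

Lemma bdry_eq0_diff (z : edge -> R) : (forall f, bdry z f = 0) ->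
  exists a : 'I_4 -> R, forall e, z e = a (tgt e) - a (src e).
Proof.
(* The potential at a vertex is the value of [z] on the edge coming from [v0], where it is set to
   0. *)
move=> h; exists (fun n => if n == v1 then z e01 else if n == v2 then z e02
  else if n == v3 then z e03 else 0).
have := (h v0, h v1, h v2, h v3); rewrite /bdry /= => -[[[h0 h1] h2] h3].
by apply: edge_ind; rewrite !src_tgt /=; lra.
Qed.

(** Let [z] vanish on the edges at [v0]. Each face through [v0] has one further edge, on which [z]
    takes the prescribed value; [alt om = 0] is exactly what the face [v0] then requires. *)
Lemma alt_eq0_bdry (om : 'I_4 -> R) : alt om = 0 -> exists z, om =1 bdry z.
Proof.
rewrite /alt => h; exists (fun e => if e == e12 then om v3 else
  if e == e13 then om v2 else if e == e23 then om v1 else 0).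
by apply: ord4_ind; rewrite /bdry /=; lra.
Qed.

End DiscreteExactness.

(** * Closed formulas for the weak operators *)

Section WeakOperators.
Context {R : realType}.
Variables (p : 'I_4 -> pt R) (F : frame R).
Hypotheses (ndp : nondegenerate_tetra p) (hF : is_frame p F).

Notation X := (face_vec p).
Notation E := (edge_vec p).

Definition kgrad : R := - (area * Num.sg (det3 p) / vol p).
Definition kcurl : R := - (Num.sg (det3 p) / vol p).

Lemma kcurl_neq0 : kcurl != 0.
Proof.
rewrite oppr_eq0 mulf_neq0 ?sgr_eq0 ?det3_neq0 // invr_eq0.
by rewrite gt_eqF // vol_gt0.
Qed.

Lemma kgrad_neq0 : kgrad != 0.
Proof.
rewrite /kgrad -mulrA -mulrN mulf_neq0 ?kcurl_neq0 //.
by rewrite gt_eqF // area_gt0.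
Qed.

(** A solution of the identities lies in [V2], hence has coordinates, and [is_wgradP] determines
    them. So [xget] returns this element and not its default value. *)
Lemma wgradE a0 af ae an : wgrad 0 p F (coch1 p a0 af ae an) =
  coch2 p (kgrad *: alt (fun f => af f *: X f)) (bdry (fun e => ae e *: E e))
    (fun e => an (tgt e) - an (src e)).
Proof.
apply: xget_unique => [|u hu].
  by apply/is_wgradP => // f; exact: bdry_face_vec0.
have /(V2P ndp hF) [u0 [y [z [Xy uE]]]] : V2 0 p F u.
  by case: u hu => [[? ?] ?] [].
move: hu; rewrite uE => /(is_wgradP ndp hF _ _ _ _ _ _ Xy) [-> /funext -> hz].
by congr coch2; apply/funext.
Qed.

Lemma wcurlE u0 y z : (forall f, dot (X f) (y f) = 0) ->
  wcurl 0 p F (coch2 p u0 y z) = coch3 p (kcurl *: alt y) (bdry z).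
Proof.
move=> Xy; apply: xget_unique => [|w hw]; first exact/is_wcurlP.
have /(V3P ndp hF) [w0 [om wE]] : V3 0 p F w.
  by case: w hw => [? ?] [].
by move: hw; rewrite wE => /(is_wcurlP ndp hF _ _ _ _ Xy) [-> /funext ->].
Qed.

Lemma wdivE w0 om : wdiv 0 p F (coch3 p w0 om) = coch4 p (kcurl * alt om).
Proof.
apply: xget_unique => [|d hd]; first exact/is_wdivP.
have /V4P [c dE] : V4 0 p d by case: hd.
by move: hd; rewrite dE => /(is_wdivP ndp hF) ->.
Qed.

End WeakOperators.

Theorem theorem6p1 (R : realType) (p : 'I_4 -> 'rV[R]_3) (F : frame R) (k : nat)
    (hp : nondegenerate_tetra p) (hF : is_frame p F) (hk : k = 0%N) :
  [/\ Iw p @` setT = Ker (V1 k p) (wgrad k p F),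
      wgrad k p F @` V1 k p = Ker (V2 k p F) (wcurl k p F),
      wcurl k p F @` V2 k p F = Ker (V3 k p F) (wdiv k p F)
    & wdiv k p F @` V3 k p F = V4 k p].
Proof.
subst k; have kg0 := kgrad_neq0 hp; have kc0 := kcurl_neq0 hp.
have zero_face (f : 'I_4) : dot (face_vec p f) 0 = 0 := dot0r _.
split; apply/seteqP; split.
- move=> _ [[[[a0 a1] a2] a3] _ <-]; rewrite IwE; split.
    by apply/V1P; exists a0, (fun=> a1), (fun=> a2), (fun=> a3).
  rewrite wgradE // -(coch2_0 p); congr coch2.
  + by rewrite (alt_face_vec_eq0 hp (fun=> a1)).2 // scaler0.
  + by apply/funext => f; rewrite (bdry_edge_vec_eq0 hp (fun=> a2)).2.
  + by apply/funext => e; rewrite subrr.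
- move=> _ [/V1P [a0 [af [ae [an ->]]]]]; rewrite wgradE // -(coch2_0 p).
  move=> /(coch2_inj hp (bdry_face_vec0 p ae) zero_face) [h0 h1 h2].
  exists (a0, af v0, ae e01, an v0) => //; rewrite IwE; congr coch1.
  + apply/funext => f; apply/esym; apply: (alt_face_vec_eq0 hp af).1 => //.
    by move/eqP: h0; rewrite scaler_eq0 (negbTE kg0) => /eqP.
  + by apply/funext => e; apply/esym; exact: (bdry_edge_vec_eq0 hp ae).1.
  (* Vanishing increments on the three edges from [v0] give every vertex the value at [v0]. *)
  + apply/funext => n.
    have := (h2 e01, h2 e02, h2 e03); rewrite !src_tgt => -[[]].
    move=> /subr0_eq r1 /subr0_eq r2 /subr0_eq r3.
    by elim/ord4_ind: n => /=; rewrite ?r1 ?r2 ?r3.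
- move=> _ [_ /V1P [a0 [af [ae [an ->]]]] <-]; rewrite wgradE //; split.
    apply/(V2P hp hF); do 3!eexists; split; last by [].
    exact: bdry_face_vec0.
  rewrite wcurlE //; last exact: bdry_face_vec0.
  rewrite -(coch3_0 p) alt_bdry_vec scaler0; congr coch3.
  by apply/funext => f; rewrite bdry_diff0.
- move=> _ [/(V2P hp hF) [u0 [y [z [Xy ->]]]]]; rewrite wcurlE // -(coch3_0 p).
  move=> /(coch3_inj hp) [/eqP + h1]; rewrite scaler_eq0 (negbTE kc0) => /eqP
    h0.
  (* The three components of [wgrad] depend separately on [af], [ae] and [an], so a preimage is
     found component by component. *)
  have [af haf] := alt_face_vec_surj hp ((kgrad p)^-1 *: u0).
  have [ae /funext hae] := bdry_edge_vec_surj hp Xy h0.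
  have [an /funext han] := bdry_eq0_diff h1.
  exists (coch1 p 0 af ae an); first by apply/V1P; exists 0, af, ae, an.
  by rewrite wgradE // haf scalerA mulfV // scale1r hae han.
- move=> _ [_ /(V2P hp hF) [u0 [y [z [Xy ->]]]] <-]; rewrite wcurlE //; split.
    by apply/(V3P hp hF); do 2!eexists.
  by rewrite wdivE // alt_bdry mulr0 coch4_0.
- move=> _ [/(V3P hp hF) [w0 [om ->]]]; rewrite wdivE // -(coch4_0 p).
  move=> /coch4_inj /eqP; rewrite mulf_eq0 (negbTE kc0) => /eqP h0.
  (* Likewise the interior component of [wcurl] depends on [y] only and the face component on [z]
     only. *)
  have [y Xy hy] := alt_tangent_surj hp ((kcurl p)^-1 *: w0).
  have [z /funext hz] := alt_eq0_bdry h0.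
  exists (coch2 p 0 y z); first by apply/(V2P hp hF); exists 0, y, z.
  by rewrite wcurlE // hy scalerA mulfV // scale1r hz.
- move=> _ [_ /(V3P hp hF) [w0 [om ->]] <-]; rewrite wdivE //.
  by apply/V4P; eexists.
- move=> _ /V4P [c ->].
  (* A flux through a single face is enough; [alt] has coefficient 1 at [v1]. *)
  exists (coch3 p 0 (fun f => if f == v1 then (kcurl p)^-1 * c else 0)).
    by apply/(V3P hp hF); do 2!eexists.
  rewrite wdivE // /alt /= oppr0 add0r !addr0 mulrA mulfV //.
  by rewrite mul1r.
Qed.
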